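(* Let $n\geq 2$ and let $K\subsetneq\mathbb{R}^n$ be a proper convex polyhedron which is neither a layer nor a hyperplane. Then: (i) If $K$ is bounded, $\mathbb{R}^n\setminus K$ and $\mathbb{R}^n\setminus\operatorname{Int}(K)$ are polynomial images of $\mathbb{R}^n$. (ii) If $K$ is unbounded, $\mathbb{R}^n\setminus K$ and $\mathbb{R}^n\setminus\operatorname{Int}(K)$ are regular images of $\mathbb{R}^n$.
   Context: A convex polyhedron in $\mathbb{R}^n$ is a finite intersection of closed affine half-spaces $\{h\geq 0\}$, $h$ a polynomial of degree one (its dimension may be smaller than $n$). $\operatorname{Int}(K)$ denotes the interior of $K$ as a topological manifold with boundary, i.e. the interior of $K$ relative to the affine subspace it spans (so $\operatorname{Int}(K)=K$ if $K$ is a point); it equals the topological interior in $\mathbb{R}^n$ when $\dim K=n$. A layer is a subset of $\mathbb{R}^n$ affinely equivalent to $[-a,a]\times\mathbb{R}^{n-1}$ with $a>0$. A map $f:\mathbb{R}^k\to\mathbb{R}^m$ is polynomial if its components are polynomials; it is regular if each component is a quotient $g/h$ of real polynomials with $h$ nowhere zero on $\mathbb{R}^k$. A set $S\subset\mathbb{R}^m$ is a polynomial (resp. regular) image of $\mathbb{R}^k$ if $S=f(\mathbb{R}^k)$ for some polynomial (resp. regular) map $f:\mathbb{R}^k\to\mathbb{R}^m$. *)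

(* Defs.v *)
From HB Require Import structures.
From mathcomp Require Import all_boot all_order all_algebra.
From mathcomp Require Import all_classical all_reals all_analysis.
(* The notations of mpoly clash with those of the analysis
   library, hence [mpoly n R] for polynomials in [n] variables. *)
From mathcomp Require Import -(notations) mpoly.

Set Implicit Arguments.
Unset Strict Implicit.
Unset Printing Implicit Defensive.

Import Order.TTheory GRing.Theory Num.Theory.
Import numFieldNormedType.Exports.

Local Open Scope classical_set_scope.
Local Open Scope ring_scope.

Definition peval (R : realType) (n : nat) (p : mpoly n R)
  (x : 'rV[R]_n) : R := meval (fun i : 'I_n => x 0 i) p.

(* [msize] is the total degree plus one (and 0 for the zero polynomial). *)
Definition degree_one (R : realType) (n : nat) (h : mpoly n R) : Prop :=
  msize h = 2%N.

Definition convex_polyhedron (R : realType) (n : nat)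
  (K : set 'rV[R]_n) : Prop :=
  exists (m : nat) (h : 'I_m -> mpoly n R),
    (forall i, degree_one (h i)) /\
    K = \bigcap_(i in [set: 'I_m]) [set x | 0 <= peval (h i) x].

Definition hyperplane (R : realType) (n : nat) (S : set 'rV[R]_n) : Prop :=
  exists h : mpoly n R, degree_one h /\ S = [set x | peval h x = 0].

(* The condition on [i] singles out the first coordinate without requiring
   [n] to be syntactically a successor. *)
Definition slab (R : realType) (n : nat) (a : R) : set 'rV[R]_n :=
  [set x | forall i : 'I_n, i = 0%N :> nat -> - a <= x 0 i <= a].

Definition layer (R : realType) (n : nat) (S : set 'rV[R]_n) : Prop :=
  exists (a : R) (A : 'M[R]_n) (b : 'rV[R]_n),
    [/\ 0 < a, A \in unitmx & S = [set x *m A + b | x in (slab a : set 'rV[R]_n)]].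

Definition affine_span (R : realType) (n : nat)
  (S : set 'rV[R]_n) : set 'rV[R]_n :=
  [set y | exists (m : nat) (p : 'I_m -> 'rV[R]_n) (w : 'I_m -> R),
    [/\ forall i, S (p i), \sum_i w i = 1 & y = \sum_i w i *: p i]].

(* [subspace A] is the ambient type with the relative topology on [A], the
   points outside [A] being isolated; since [K] is contained in its affine
   span, the latter do not matter here. *)
Definition Int (R : realType) (n : nat) (K : set 'rV[R]_n) : set 'rV[R]_n :=
  interior (K : set (subspace (affine_span K))).

Definition polynomial_map (R : realType) (k m : nat)
  (f : 'rV[R]_k -> 'rV[R]_m) : Prop :=
  forall j : 'I_m, exists p : mpoly k R, forall x, f x 0 j = peval p x.

Definition regular_map (R : realType) (k m : nat)
  (f : 'rV[R]_k -> 'rV[R]_m) : Prop :=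
  forall j : 'I_m, exists g h : mpoly k R,
    (forall x, peval h x != 0) /\
    (forall x, f x 0 j = peval g x / peval h x).

Definition polynomial_image (R : realType) (k m : nat)
  (S : set 'rV[R]_m) : Prop :=
  exists f : 'rV[R]_k -> 'rV[R]_m, polynomial_map f /\ S = range f.

Definition regular_image (R : realType) (k m : nat)
  (S : set 'rV[R]_m) : Prop :=
  exists f : 'rV[R]_k -> 'rV[R]_m, regular_map f /\ S = range f.

(* Main.v *)
Require Import Defs.
From mathcomp Require Import all_boot all_order all_algebra.
From mathcomp Require Import all_classical all_reals all_analysis.
From mathcomp Require Import -(notations) mpoly.
From mathcomp Require Import ring lra.
Import Order.TTheory GRing.Theory Num.Theory.
Import numFieldNormedType.Exports.
Local Open Scope classical_set_scope.
Local Open Scope ring_scope.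

(** Both K and Int K are defined by affine constraints h <= 0 or h < 0.  They
are carved out of a larger set one constraint at a time, by polynomial or
regular maps which send every line of a fixed direction v into itself.  Let C
be the set carved so far, with convex fibres along v, and let Q >= 0 vanish at
the ends of all these fibres.

- To add h <= 0, take v parallel to h = 0 and t |-> t - h t Q(t) on each line.
  On h = 0 this is the identity.  On h < 0 the ends of the fibre are fixed and
  the outside is mapped onto itself, if Q is divided by a large enough D.  On
  h > 0, if the fibre is bounded, the map exchanges the two ends of the line,
  so the image of the outside of the fibre is the whole line.
- To add h < 0, take v with h(v) = 1 and t |-> t (1 - t Q(t))^2, where t = h.
  Below h = 0 the outside of the fibre is preserved; past the upper end of the
  fibre, t Q(t) takes the value 1, so the dip to 0 covers all of h >= 0.

For bounded K, the start is C = {x_0 > |x'|^2 - c}, whose complement is the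
image of x_0 |-> |x'|^2 - c - x_0^2; after the constraint x_0 <= M everything is
bounded and D can be constant.  For unbounded K, the start is a half-space, and
D is a power of 1 + |x'|^2.  The bounded fibres needed for h <= 0 are obtained
by first adding the strict constraint h < 1 / (1 + |x'|^2).  This works as soon
as two constraints are not parallel; the remaining polyhedra are half-spaces,
layers and hyperplanes. *)

Set Implicit Arguments.
Unset Strict Implicit.
Unset Printing Implicit Defensive.

(** * Stretching maps of the line *)

Section Line.
Variable R : realType.
Implicit Types (I : set R) (Q g : R -> R) (a b c r s t x y z : R).

Definition line_adherent I b := forall e, 0 < e -> exists2 r, I r & `|r - b| < e.

Definition line_interior I b :=
  exists2 e, 0 < e & forall r, `|r - b| < e -> I r.

(* The ends of the interval [I], if any, are zeros of [Q]. *)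
Definition ends_at_zeros I Q :=
  is_interval I /\ forall b, line_adherent I b -> Q b != 0 -> line_interior I b.

Definition tends_to_infty g := forall M, exists T, forall t, T <= t -> M <= g t.

Lemma ivt g x y z : continuous g -> x <= y ->
  (g x <= z <= g y) || (g y <= z <= g x) -> exists2 c, x <= c <= y & g c = z.
Proof.
move=> cg xy H.
have [c] : exists2 c, c \in `[x, y] & g c = z.
  apply: IVT => //; first exact: continuous_subspaceT.
  by rewrite ge_min le_max; case/orP: H => /andP[-> ->]; rewrite ?orbT.
by rewrite in_itv; exists c.
Qed.

(** The end is [sup I]: if [Q] were nonzero there, [I] would contain points beyond its supremum. *)
Lemma right_end I Q x y : ends_at_zeros I Q -> I x -> ~ I y -> x < y ->
  exists b, [/\ x <= b <= y, Q b = 0, line_adherent I b & forall r, I r -> r <= b].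
Proof.
move=> [iI ends] Ix nIy xy.
have ub r : I r -> r <= y.
  move=> Ir; rewrite leNgt; apply/negP => yr; apply: nIy.
  by apply: (iI x r) => //; lra.
have hs : has_sup I by split; [exists x | exists y => r /ub].
have ubs r : I r -> r <= sup I by move=> Ir; apply: ub_le_sup => //; case: hs.
have adh : line_adherent I (sup I).
  move=> e e0; have [r Ir rs] := sup_adherent e0 hs.
  by exists r => //; have := ubs _ Ir; rewrite ltr_norml; lra.
exists (sup I); split=> //.
- by rewrite ubs //=; apply: ge_sup; [exists x | move=> r /ub].
apply/eqP; apply: contrapT => /negP Qn0.
have [e e0 /(_ (sup I + e / 2))] := ends _ adh Qn0.
have e2 : `|sup I + e / 2 - sup I| < e by rewrite ltr_norml; lra.
by move=> /(_ e2)/ubs; lra.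
Qed.

Lemma left_end I Q x y : ends_at_zeros I Q -> I x -> ~ I y -> y < x ->
  exists b, [/\ y <= b <= x, Q b = 0, line_adherent I b & forall r, I r -> b <= r].
Proof.
move=> [iI ends] Ix nIy yx.
have opp P : line_adherent (fun t => I (- t)) P -> line_adherent I (- P).
  move=> H e e0; have [r Ir rP] := H e e0.
  by exists (- r) => //; move: rP; rewrite !ltr_norml; lra.
have [||||b [bP Qb adh ub]] :=
    @right_end (fun t => I (- t)) (fun t => Q (- t)) (- x) (- y).
- split=> [u v Iu Iv w uvw|b /opp adh Qb].
    by apply: (iI (- v) (- u)) => //; lra.
  have [e e0 H] := ends _ adh Qb; exists e => // r rb.
  by apply: H; move: rb; rewrite !ltr_norml; lra.
- by rewrite opprK.
- by rewrite opprK.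
- lra.
exists (- b); split=> //; first lra; first exact: opp.
by move=> r Ir; have := ub (- r); rewrite opprK => /(_ Ir); lra.
Qed.

Lemma ivt_up g x z : continuous g -> tends_to_infty g -> g x <= z ->
  exists2 t, x <= t & g t = z.
Proof.
move=> cg ginf gxz; have [T gT] := ginf z.
have xM : x <= Num.max x T by rewrite le_max lexx.
have [|t /andP[xt _] gt] := ivt (z := z) cg xM; last by exists t.
by rewrite gxz gT // le_max lexx orbT.
Qed.

Lemma continuous_flip g : continuous g -> continuous (fun t => g (- t)).
Proof. by move=> cg t; apply: continuous_comp; [exact: opp_continuous | exact: cg]. Qed.

(** * Images of the outside of an interval under three kinds of stretching *)

Section Trimming.
Variables (I : set R) (Q : R -> R).
Hypotheses (cQ : continuous Q) (Qge0 : forall t, 0 <= Q t).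
Hypothesis (IQ : ends_at_zeros I Q).

Lemma continuous_stretch eta : continuous (fun t => t - eta * t * Q t).
Proof.
move=> t; apply: cvgB; first exact: cvg_id.
apply: cvgM; last exact: cQ.
by apply: cvgM; [exact: cvg_cst | exact: cvg_id].
Qed.

(** For [eta < 0] points move away from 0, so an end [b] could only be crossed by points between 0
    and [b]; [small] excludes this. Ends are fixed, hence each side of an end is mapped into itself,
    and onto itself by the intermediate value theorem. *)
Lemma expanding_stretch eta y : eta < 0 ->
  (forall b t, line_adherent I b -> Q b = 0 ->
     (b < t <= 0) || (0 <= t < b) -> - eta * `|t| * Q t < `|t - b|) ->
  (exists2 t, ~ I t & t - eta * t * Q t = y) <-> ~ I y.
Proof.
move=> eta0 small; set g := fun t => t - eta * t * Q t.
have cg : continuous g by apply: continuous_stretch.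
have ge t : 0 <= t -> t <= g t.
  move=> t0; rewrite /g; have e0 : 0 <= - eta by lra.
  by have := mulr_ge0 (mulr_ge0 e0 t0) (Qge0 t); lra.
have le t : t <= 0 -> g t <= t.
  move=> t0; rewrite /g; have nt : 0 <= eta * t by nra.
  by have := mulr_ge0 nt (Qge0 t); lra.
have gfix b : Q b = 0 -> g b = b by rewrite /g => ->; lra.
have top x z : g x <= z -> exists2 t, x <= t & g t = z.
  apply: ivt_up => // M; exists (Num.max 0 M) => t; rewrite ge_max => /andP[t0 Mt].
  exact: le_trans Mt (ge _ t0).
have bot x z : z <= g x -> exists2 t, t <= x & g t = z.
  move=> zx; have [|||t xt /oppr_inj gt] :=
    @ivt_up (fun t => - g (- t)) (- x) (- z).
  - by move=> t; apply: cvgN; exact: (continuous_flip cg).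
  - move=> M; exists (Num.max 0 M) => t; rewrite ge_max => /andP[t0 Mt].
    by have := le (- t); lra.
  - by rewrite opprK lerN2.
  - by exists (- t) => //; lra.
have right b t : line_adherent I b -> Q b = 0 -> b < t -> b < g t.
  move=> Ib Qb bt; have [t0|t0] := leP 0 t; first by have := ge _ t0; lra.
  have := small b t Ib Qb; rewrite bt (ltW t0) => /(_ isT).
  by rewrite (ltr0_norm t0) gtr0_norm ?subr_gt0 // /g; lra.
have left b t : line_adherent I b -> Q b = 0 -> t < b -> g t < b.
  move=> Ib Qb bt; have [t0|t0] := leP t 0; first by have := le _ t0; lra.
  have := small b t Ib Qb; rewrite bt (ltW t0) orbT => /(_ isT).
  by rewrite (gtr0_norm t0) ltr0_norm ?subr_lt0 // /g; lra.
split=> [[t nIt <-]|nIy].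
  move=> Igt; case: (ltgtP (g t) t) => [gtt|tgt|gtt].
  - have [b [/andP[b1 b2] Qb Ib ub]] := right_end IQ Igt nIt gtt.
    move: b2; rewrite le_eqVlt => /orP[/eqP bt|/(right _ _ Ib Qb)].
      by move: gtt; rewrite -bt gfix // ltxx.
    by have := ub _ Igt; rewrite /g; lra.
  - have [b [/andP[b1 b2] Qb Ib ub]] := left_end IQ Igt nIt tgt.
    move: b1; rewrite le_eqVlt => /orP[/eqP bt|/(left _ _ Ib Qb)].
      by move: tgt; rewrite bt gfix // ltxx.
    by have := ub _ Igt; rewrite /g; lra.
  - by apply: nIt; rewrite -gtt.
(* An empty [I] has no end to start from; the fixed point 0 takes its place. *)
have [[x Ix]|nI] := pselect (exists x, I x); last first.
  have [y0|y0] := leP y 0.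
    have [|t _ gt] := bot 0 y; first by rewrite /g; lra.
    by exists t => // It; apply: nI; exists t.
  have [|t _ gt] := top 0 y; first by rewrite /g; lra.
  by exists t => // It; apply: nI; exists t.
case: (ltgtP x y) => [xy|yx|xy]; last by rewrite xy in Ix.
- have [b [/andP[b1 b2] Qb Ib ub]] := right_end IQ Ix nIy xy.
  have [|t bt gt] := top b y; first by rewrite gfix.
  exists t => // It; have tb : t = b by have := ub _ It; lra.
  by apply: nIy; rewrite -gt tb gfix // -tb.
- have [b [/andP[b1 b2] Qb Ib ub]] := left_end IQ Ix nIy yx.
  have [|t bt gt] := bot b y; first by rewrite gfix.
  exists t => // It; have tb : t = b by have := ub _ It; lra.
  by apply: nIy; rewrite -gt tb gfix // -tb.
Qed.

(** For [eta > 0] the map exchanges the two ends of the line. The part beyond the upper end [b],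
    which is fixed, covers all that is below [b], and the part beyond the lower end [a] all that is
    above [a]. Since [a <= b], only the case [a = b = y] remains. *)
Lemma reversing_stretch eta y B : 0 < eta ->
  (forall t, I t -> `|t| <= B) ->
  tends_to_infty Q -> tends_to_infty (fun t => Q (- t)) ->
  exists2 t, ~ I t & t - eta * t * Q t = y.
Proof.
move=> eta0 IB Qp Qm; set g := fun t => t - eta * t * Q t.
have cg : continuous g by apply: continuous_stretch.
have gfix b : Q b = 0 -> g b = b by rewrite /g => ->; lra.
have big q : 2 / eta <= q -> 2 <= eta * q by rewrite ler_pdivrMr // mulrC.
have top x z : z <= g x -> exists2 t, x <= t & g t = z.
  move=> zx; have [|||t xt /oppr_inj gt] :=
    @ivt_up (fun t => - g t) x (- z); last by exists t.
  - by move=> t; apply: cvgN; exact: cg.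
  - move=> M; have [T QT] := Qp (2 / eta); exists (Num.max (Num.max 0 M) T) => t.
    rewrite !ge_max => /andP[/andP[t0 Mt] /QT/big tQ].
    by rewrite /g; nra.
  - by rewrite lerN2.
have bot x z : g x <= z -> exists2 t, t <= x & g t = z.
  move=> xz; have [|||t xt gt] := @ivt_up (fun t => g (- t)) (- x) z.
  - exact: continuous_flip.
  - move=> M; have [T QT] := Qm (2 / eta); exists (Num.max (Num.max 0 M) T) => t.
    rewrite !ge_max => /andP[/andP[t0 Mt] /QT/big tQ].
    by rewrite /g; nra.
  - by rewrite opprK.
  - by exists (- t) => //; lra.
have [[x Ix]|nI] := pselect (exists x, I x); last first.
  have [y0|y0] := leP y 0.
    have [|t _ gt] := top 0 y; first by rewrite /g; lra.
    by exists t => // It; apply: nI; exists t.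
  have [|t _ gt] := bot 0 y; first by rewrite /g; lra.
  by exists t => // It; apply: nI; exists t.
have xB := IB _ Ix; have := ler_norm x => xx.
have nx : - x <= B by have := ler_norm (- x); rewrite normrN; lra.
have [||b [_ Qb _ ub]] := @right_end I Q x (B + 1) IQ Ix.
- by move=> /IB; have := ler_norm (B + 1); lra.
- lra.
have [||a [_ Qa _ ua]] := @left_end I Q x (- B - 1) IQ Ix.
- by move=> /IB; have := ler_norm (- (- B - 1)); rewrite normrN; lra.
- lra.
have [yb|by_] := ltP y b.
  have [|t bt gt] := top b y; first by rewrite gfix // ltW.
  exists t => // /ub tb; have : t = b by lra.
  by move=> tb'; move: gt; rewrite tb' gfix //; lra.
have [ay|ya] := ltP a y.
  have [|t bt gt] := bot a y; first by rewrite gfix // ltW.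
  exists t => // /ua tb; have : t = a by lra.
  by move=> tb'; move: gt; rewrite tb' gfix //; lra.
have ab : a = y /\ b = y by have := ub _ Ix; have := ua _ Ix; lra.
(* The fibre is the single point [y]: it is reached from its other side. *)
case: ab => ay by'; subst a b => {ya by_}.
case: (ltgtP y 0) => y0.
(* Starting at [y / 2] instead of [y] yields a preimage other than [y] itself. *)
- have [|t bt gt] := top (y / 2) y.
    by rewrite /g; have := mulr_ge0 (ltW eta0) (Qge0 (y / 2)); nra.
  by exists t => // /ub; lra.
- have [|t bt gt] := bot (y / 2) y.
    by rewrite /g; have := mulr_ge0 (ltW eta0) (Qge0 (y / 2)); nra.
  by exists t => // /ua; lra.
(* At [y = 0] the other preimage is a zero of [1 - eta * Q t]. *)
have [|t0 t0y Qt] := @ivt_up Q y (1 / eta) cQ Qp.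
  by rewrite Qb divr_ge0 // ltW.
exists t0; last by rewrite /g Qt y0; field; rewrite gt_eqF.
move=> /ub t0y'; have e : t0 = y by lra.
have := divr_gt0 (ltr01 : 0 < 1 :> R) eta0; rewrite -Qt e Qb; lra.
Qed.

(** The two half-lines at 0 are preserved and no negative point moves to the right, so below 0 only
    an upper end of [I] could be crossed; [small] excludes this. *)
Lemma dipping_stretch y :
  tends_to_infty Q -> (exists B, forall t, I t -> t <= B) ->
  (forall b t, line_adherent I b -> (forall r, I r -> r <= b) -> Q b = 0 ->
     b < t < 0 -> - t * ((1 - t * Q t) ^+ 2 - 1) < t - b) ->
  (exists2 t, ~ I t & t * (1 - t * Q t) ^+ 2 = y) <-> ~ (I y /\ y < 0).
Proof.
move=> Qp [B IB] small; set g := fun t => t * (1 - t * Q t) ^+ 2.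
have cg : continuous g.
  move=> t; apply: cvgM; first exact: cvg_id.
  apply: cvgM; apply: cvgB; try exact: cvg_cst;
    by apply: cvgM; [exact: cvg_id | exact: cQ].
have gfix b : Q b = 0 -> g b = b by rewrite /g => ->; ring.
have g0 : g 0 = 0 by rewrite /g mul0r.
have le t : t <= 0 -> g t <= t.
  move=> t0; have := mulr_ge0 (_ : 0 <= - t) (Qge0 t); rewrite oppr_ge0 => /(_ t0) H.
  rewrite /g; have : 1 <= (1 - t * Q t) ^+ 2 by nra.
  nra.
have ge0 t : 0 <= t -> 0 <= g t by move=> t0; rewrite mulr_ge0 // sqr_ge0.
have ginf : tends_to_infty g.
  move=> M; have [T QT] := Qp 2; exists (Num.max (Num.max 1 M) T) => t.
  rewrite !ge_max => /andP[/andP[t0 Mt] /QT tQ].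
  have tQ2 : 2 <= t * Q t by nra.
  have : 1 <= (1 - t * Q t) ^+ 2 by move: (t * Q t) tQ2 => u u2; nra.
  by rewrite /g; nra.
split=> [[t nIt <-] [Igt gt0]|nIy].
  have t0 : t < 0 by rewrite ltNge; apply/negP => /ge0; rewrite /g; lra.
  have := le _ (ltW t0); rewrite le_eqVlt => /orP[/eqP gtt|gtt].
    by apply: nIt; rewrite -gtt.
  have [b [/andP[b1 b2] Qb Ib ub]] := right_end IQ Igt nIt gtt.
  move: b2; rewrite le_eqVlt => /orP[/eqP bt|bt].
    by move: gtt; rewrite -bt gfix // ltxx.
  have := small b t Ib ub Qb; rewrite bt t0 => /(_ isT).
  by have := ub _ Igt; rewrite /g; lra.
have [y0|y0] := leP 0 y.
  (* [b] is the upper end of [I], or 0 if [I] has no nonnegative point. Either way [t * Q t]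
     vanishes at [b] and reaches 1 beyond it, at a zero of [g] from which [g] climbs to infinity. *)
  have [b [b0 bQ ub]] : exists b, [/\ 0 <= b, b * Q b = 0 & forall t, b < t -> ~ I t].
    have [[x [Ix x0]]|nI] := pselect (exists x, I x /\ 0 <= x); last first.
      exists 0; rewrite mul0r; split=> // t t0 It.
      by apply: nI; exists t; split=> //; exact: ltW.
    have xB := IB _ Ix.
    have [||b [bP Qb _ ub]] := @right_end I Q x (B + 1) IQ Ix; [by move=> /IB; lra|lra|].
    exists b; rewrite Qb mulr0; split=> //; first lra.
    by move=> t bt /ub; lra.
  have [|||t0 bt0 tQ] := @ivt_up (fun t => t * Q t) b 1; rewrite ?bQ //.
  - by move=> t; apply: cvgM; [exact: cvg_id | exact: cQ].
  - move=> M; have [T QT] := Qp (Num.max 0 M); exists (Num.max 1 T) => t.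
    rewrite ge_max => /andP[t1 /QT]; rewrite ge_max => /andP[Q0 MQ]; nra.
  have [|t t0t gt] := @ivt_up g t0 y cg ginf; first by rewrite /g tQ; lra.
  exists t => //; apply: ub; apply: lt_le_trans t0t.
  rewrite lt_neqAle bt0 andbT; apply/eqP => e.
  by move: bQ; rewrite e tQ; lra.
have {nIy} nIy : ~ I y by move=> Iy; apply: nIy.
have gy := le _ (ltW y0).
have [[x [Ix xy]]|nI] := pselect (exists x, I x /\ x < y).
  have [b [/andP[b1 b2] Qb Ib ub]] := right_end IQ Ix nIy xy.
  have [||t /andP[bt t0] gt] := @ivt g b 0 y cg; first lra.
    by rewrite gfix // g0 b2 (ltW y0).
  exists t => // It; have tb : t = b by have := ub _ It; lra.
  by apply: nIy; rewrite -gt tb gfix // -tb.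
have [[x Ix]|nI'] := pselect (exists x, I x); last first.
  have [||t _ gt] := @ivt g y 0 y cg; rewrite ?(ltW y0) // ?g0 ?gy ?(ltW y0) //.
  by exists t => // It; apply: nI'; exists t.
have yx : y < x.
  case: (ltgtP x y) => // xy; first by case: nI; exists x.
  by rewrite xy in Ix.
have [a [/andP[a1 a2] Qa Ia ua]] := left_end IQ Ix nIy yx.
(* When [a >= 0], a preimage in [[y, 0]] could lie in [I] only if it were 0, whose image is not
   [y]. *)
have [a0|a0] := leP 0 a.
  have [||t /andP[yt t0] gt] := @ivt g y 0 y cg; rewrite ?(ltW y0) // ?g0 ?gy ?(ltW y0) //.
  exists t => // /ua ta; have tt : t = 0 by lra.
  by move: gt; rewrite tt g0; lra.
have [|t /andP[yt ta] gt] := @ivt g y a y cg a1; first by rewrite gy (gfix a) // a1.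
exists t => // It; have tb : t = a by have := ua _ It; lra.
by apply: nIy; rewrite -gt tb gfix // -tb.
Qed.

End Trimming.
End Line.

(** * Polynomial and regular functions *)

Section Functions.
Variables (R : realType) (n : nat).
Implicit Types (F G : 'rV[R]_n -> R) (x v a : 'rV[R]_n) (p q : mpoly n R).

Definition polyfun F := exists p, forall x, F x = peval p x.

Definition regfun F := exists g h, (forall x, peval h x != 0) /\
  (forall x, F x = peval g x / peval h x).

(** The boolean lets one argument serve for both regular and polynomial maps. *)
Definition fun_class (reg : bool) F := if reg then regfun F else polyfun F.

Lemma pevalC c x : peval (mpolyC n c) x = c.
Proof. exact: mevalC. Qed.

Lemma pevalD p q x : peval (p + q) x = peval p x + peval q x.
Proof. exact: mevalD. Qed.

Lemma pevalM p q x : peval (p * q) x = peval p x * peval q x.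
Proof. exact: mevalM. Qed.

Lemma polyfun_cst c : polyfun (fun=> c).
Proof. by exists (mpolyC n c) => x; rewrite pevalC. Qed.

Lemma polyfun_coord i : polyfun (fun x => x 0 i).
Proof. by exists (mpolyX R (mnm1 i)) => x; rewrite /peval mevalXU. Qed.

Lemma polyfunD F G : polyfun F -> polyfun G -> polyfun (fun x => F x + G x).
Proof. by move=> [p Fp] [q Gq]; exists (p + q) => x; rewrite pevalD Fp Gq. Qed.

Lemma polyfunM F G : polyfun F -> polyfun G -> polyfun (fun x => F x * G x).
Proof. by move=> [p Fp] [q Gq]; exists (p * q) => x; rewrite pevalM Fp Gq. Qed.

(** The monomial expansion builds a polynomial function from constants and coordinates by sums and
    products; later proofs argue on these four cases instead of on coefficients. *)
Lemma peval_ind (P : ('rV[R]_n -> R) -> Prop) :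
  (forall c, P (fun=> c)) -> (forall i, P (fun x => x 0 i)) ->
  (forall F G, P F -> P G -> P (fun x => F x + G x)) ->
  (forall F G, P F -> P G -> P (fun x => F x * G x)) ->
  forall F, polyfun F -> P F.
Proof.
move=> Pc Px PD PM F [p Fp]; have -> : F = peval p by apply/funext.
have PX F' k : P F' -> P (fun x => F' x ^+ k).
  move=> PF; elim: k => [|k IH]; first exact: Pc.
  by rewrite (_ : (fun _ => _) = fun x => F' x * F' x ^+ k); [exact: PM|apply/funext => x; rewrite exprS].
have Psum (T : Type) (s : seq T) (f : T -> 'rV[R]_n -> R) :
    (forall k, P (f k)) -> P (fun x => \sum_(k <- s) f k x).
  move=> Pf; elim: s => [|k s IH].
    by rewrite (_ : (fun _ => _) = fun=> 0); [exact: Pc|apply/funext => x; rewrite big_nil].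
  by rewrite (_ : (fun _ => _) = fun x => f k x + \sum_(k <- s) f k x);
    [exact: PD|apply/funext => x; rewrite big_cons].
have Pprod (T : Type) (s : seq T) (f : T -> 'rV[R]_n -> R) :
    (forall k, P (f k)) -> P (fun x => \prod_(k <- s) f k x).
  move=> Pf; elim: s => [|k s IH].
    by rewrite (_ : (fun _ => _) = fun=> 1); [exact: Pc|apply/funext => x; rewrite big_nil].
  by rewrite (_ : (fun _ => _) = fun x => f k x * \prod_(k <- s) f k x);
    [exact: PM|apply/funext => x; rewrite big_cons].
rewrite (_ : peval p = fun x => \sum_(m <- msupp p) mcoeff m p * \prod_i x 0 i ^+ m i).
  by apply: Psum => m; apply: PM => //; apply: Pprod => i; exact: PX.
by apply/funext => x; rewrite /peval mevalE.
Qed.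

Lemma polyfun_regfun F : polyfun F -> regfun F.
Proof.
move=> [p Fp]; exists p, (mpolyC n 1).
by split=> x; rewrite pevalC ?oner_neq0 // Fp divr1.
Qed.

Lemma polyfun_class reg F : polyfun F -> fun_class reg F.
Proof. by case: reg => //; exact: polyfun_regfun. Qed.

Lemma fun_class_cst reg c : fun_class reg (fun=> c).
Proof. exact/polyfun_class/polyfun_cst. Qed.

Lemma fun_class_coord reg i : fun_class reg (fun x => x 0 i).
Proof. exact/polyfun_class/polyfun_coord. Qed.

Lemma fun_classM reg F G :
  fun_class reg F -> fun_class reg G -> fun_class reg (fun x => F x * G x).
Proof.
case: reg; last exact: polyfunM.
move=> [p [q [q0 Fpq]]] [p' [q' [q'0 Gpq]]]; exists (p * p'), (q * q').
by split=> x; rewrite !pevalM ?mulf_neq0 // Fpq Gpq invfM mulrACA.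
Qed.

Lemma fun_classD reg F G :
  fun_class reg F -> fun_class reg G -> fun_class reg (fun x => F x + G x).
Proof.
case: reg; last exact: polyfunD.
move=> [p [q [q0 Fpq]]] [p' [q' [q'0 Gpq]]].
exists (p * q' + p' * q), (q * q').
split=> x; first by rewrite pevalM mulf_neq0.
by rewrite pevalD !pevalM Fpq Gpq addf_div.
Qed.

Lemma fun_classN reg F : fun_class reg F -> fun_class reg (fun x => - F x).
Proof.
move=> FF; rewrite (_ : (fun _ => _) = fun x => -1 * F x).
  by apply: fun_classM => //; exact: fun_class_cst.
by apply/funext => x; rewrite mulN1r.
Qed.

Lemma fun_classB reg F G :
  fun_class reg F -> fun_class reg G -> fun_class reg (fun x => F x - G x).
Proof. by move=> FF FG; apply: fun_classD => //; exact: fun_classN. Qed.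

Lemma fun_classX reg F k : fun_class reg F -> fun_class reg (fun x => F x ^+ k).
Proof.
move=> FF; elim: k => [|k IH]; first exact: fun_class_cst.
rewrite (_ : (fun _ => _) = fun x => F x * F x ^+ k); first exact: fun_classM.
by apply/funext => x; rewrite exprS.
Qed.

Lemma fun_class_sum reg (T : Type) (s : seq T) (f : T -> 'rV[R]_n -> R) :
  (forall k, fun_class reg (f k)) -> fun_class reg (fun x => \sum_(k <- s) f k x).
Proof.
move=> Pf; elim: s => [|k s IH].
  rewrite (_ : (fun _ => _) = fun=> 0); first exact: fun_class_cst.
  by apply/funext => x; rewrite big_nil.
rewrite (_ : (fun _ => _) = fun x => f k x + \sum_(k <- s) f k x); first exact: fun_classD.
by apply/funext => x; rewrite big_cons.
Qed.

Lemma fun_class_prod reg (T : Type) (s : seq T) (P : pred T) (f : T -> 'rV[R]_n -> R) :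
  (forall k, fun_class reg (f k)) ->
  fun_class reg (fun x => \prod_(k <- s | P k) f k x).
Proof.
move=> Pf; elim: s => [|k s IH].
  rewrite (_ : (fun _ => _) = fun=> 1); first exact: fun_class_cst.
  by apply/funext => x; rewrite big_nil.
rewrite (_ : (fun _ => _) = fun x =>
  (if P k then f k x else 1) * \prod_(k <- s | P k) f k x).
  by apply: fun_classM => //; case: (P k) => //; exact: fun_class_cst.
by apply/funext => x; rewrite big_cons; case: (P k); rewrite ?mul1r.
Qed.

Lemma regfunV F : regfun F -> (forall x, F x != 0) -> regfun (fun x => (F x)^-1).
Proof.
move=> [p [q [q0 Fpq]]] F0; exists q, p; split=> x.
  by have := F0 x; rewrite Fpq mulf_eq0 negb_or => /andP[].
by rewrite Fpq invf_div.
Qed.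

Definition map_class reg (f : 'rV[R]_n -> 'rV[R]_n) :=
  forall j, fun_class reg (fun x => f x 0 j).

Lemma polyfun_comp reg F f : polyfun F -> map_class reg f ->
  fun_class reg (fun x => F (f x)).
Proof.
move=> PF cf; move: F PF.
apply: (@peval_ind (fun F => fun_class reg (fun x => F (f x)))) => [c|i|F G|F G].
- exact: fun_class_cst.
- exact: cf.
- exact: fun_classD.
- exact: fun_classM.
Qed.

Lemma fun_class_comp reg F f : fun_class reg F -> map_class reg f ->
  fun_class reg (fun x => F (f x)).
Proof.
case: reg; last exact: polyfun_comp.
move=> [p [q [q0 Fpq]]] cf.
rewrite (_ : (fun _ => _) = fun x => peval p (f x) * (peval q (f x))^-1).
  have pq p' : fun_class true (fun x => peval p' (f x)).
    by apply: (@polyfun_comp true (peval p')) => //; exists p'.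
  by apply: (@fun_classM true (fun x => peval p (f x))) => //; apply: (regfunV (pq q)) => x; exact: q0.
by apply/funext => x; rewrite Fpq.
Qed.

Definition is_image reg (S : set 'rV[R]_n) :=
  exists2 f, map_class reg f & S = range f.

Lemma is_image_map reg (S T : set 'rV[R]_n) f :
  is_image reg S -> map_class reg f -> f @` S = T -> is_image reg T.
Proof.
move=> [g cg ->] cf <-; exists (f \o g); first by move=> j; exact: fun_class_comp (cf j) cg.
by rewrite image_comp.
Qed.

Lemma is_imageT reg : is_image reg [set: 'rV[R]_n].
Proof.
exists id; first by move=> j; exact: fun_class_coord.
by rewrite image_id.
Qed.

Lemma is_image_poly (S : set 'rV[R]_n) : is_image false S -> polynomial_image n S.
Proof. by move=> [f cf ->]; exists f. Qed.

Lemma is_image_reg (S : set 'rV[R]_n) : is_image true S -> regular_image n S.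
Proof. by move=> [f cf ->]; exists f. Qed.

End Functions.

(** * Estimates along lines *)

Section PowerBounds.
Variables (R : realType) (T : Type) (D : set T) (w : T -> R).
Hypothesis w1 : forall z, D z -> 1 <= w z.
Implicit Types F G : T -> R.

(** Polynomial growth in the weight [w], uniform on [D]; such a bound later becomes the denominator
    [A * energy x ^+ k]. *)
Definition power_bounded F :=
  exists A k, 0 <= A /\ forall z, D z -> `|F z| <= A * w z ^+ k.

Lemma power_bounded_cst c : power_bounded (fun=> c).
Proof. by exists `|c|, 0%N; split=> // z _; rewrite expr0 mulr1. Qed.

Lemma power_bounded_weight : power_bounded w.
Proof.
exists 1, 1%N; split=> // z /w1 wz.
by rewrite ger0_norm ?mul1r ?expr1 //; lra.
Qed.

Lemma power_bounded_le F G : power_bounded G ->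
  (forall z, D z -> `|F z| <= `|G z|) -> power_bounded F.
Proof.
move=> [A [k [A0 GA]]] FG; exists A, k; split=> // z Dz.
exact: le_trans (FG z Dz) (GA z Dz).
Qed.

Lemma power_boundedD F G : power_bounded F -> power_bounded G ->
  power_bounded (fun z => F z + G z).
Proof.
move=> [A [k [A0 FA]]] [B [l [B0 GB]]]; exists (A + B), (k + l)%N; split=> [|z Dz]; first lra.
apply: le_trans (ler_normD _ _) _; rewrite mulrDl; apply: lerD.
  apply: le_trans (FA z Dz) _; apply: ler_wpM2l => //.
  by apply: ler_weXn2l; rewrite ?w1 ?leq_addr.
apply: le_trans (GB z Dz) _; apply: ler_wpM2l => //.
by apply: ler_weXn2l; rewrite ?w1 ?leq_addl.
Qed.

Lemma power_boundedM F G : power_bounded F -> power_bounded G ->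
  power_bounded (fun z => F z * G z).
Proof.
move=> [A [k [A0 FA]]] [B [l [B0 GB]]]; exists (A * B), (k + l)%N; split=> [|z Dz].
  exact: mulr_ge0.
by rewrite normrM exprD mulrACA; apply: ler_pM => //; [exact: FA | exact: GB].
Qed.

Lemma power_boundedX F j : power_bounded F -> power_bounded (fun z => F z ^+ j).
Proof.
move=> bF; elim: j => [|j IH]; first exact: power_bounded_cst.
apply: power_bounded_le (power_boundedM bF IH) _ => z _.
by rewrite exprS.
Qed.

Lemma power_bounded_norm F : power_bounded F -> power_bounded (fun z => `|F z|).
Proof. by move/power_bounded_le; apply=> z _; rewrite normr_id. Qed.
End PowerBounds.

(** * Scalar product, and growth of polynomial functions along lines *)

Section Dot.
Variables (R : realType) (n : nat).
Implicit Types (x y v a : 'rV[R]_n) (s t b c : R).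

Definition dot x y := \sum_i x 0 i * y 0 i.

Lemma dotC x y : dot x y = dot y x.
Proof. by apply: eq_bigr => i _; rewrite mulrC. Qed.

Lemma dotDr x y z : dot x (y + z) = dot x y + dot x z.
Proof. by rewrite -big_split; apply: eq_bigr => i _; rewrite mxE mulrDr. Qed.

Lemma dotZr x c y : dot x (c *: y) = c * dot x y.
Proof. by rewrite mulr_sumr; apply: eq_bigr => i _; rewrite mxE mulrCA. Qed.

Lemma dotDl x y z : dot (y + z) x = dot y x + dot z x.
Proof. by rewrite ![dot _ x]dotC dotDr. Qed.

Lemma dotZl x c y : dot (c *: y) x = c * dot y x.
Proof. by rewrite ![dot _ x]dotC dotZr. Qed.

Lemma dotNr x y : dot x (- y) = - dot x y.
Proof. by rewrite -scaleN1r dotZr mulN1r. Qed.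

Lemma dotBr x y z : dot x (y - z) = dot x y - dot x z.
Proof. by rewrite dotDr dotNr. Qed.

Lemma dotBl x y z : dot (y - z) x = dot y x - dot z x.
Proof. by rewrite ![dot _ x]dotC dotBr. Qed.

Lemma dot_delta (a : 'rV[R]_n) i : dot a (delta_mx 0 i) = a 0 i.
Proof.
rewrite /dot (bigD1 i) //= mxE !eqxx mulr1 big1 ?addr0 // => j /negPf ji.
by rewrite mxE ji mulr0.
Qed.

Lemma dot_ge0 x : 0 <= dot x x.
Proof. by apply: sumr_ge0 => i _; rewrite -expr2 sqr_ge0. Qed.

Lemma dot_gt0 x : x != 0 -> 0 < dot x x.
Proof.
move=> x0; rewrite lt_neqAle dot_ge0 andbT eq_sym; apply: contra x0 => /eqP.
have sq i : i \in index_enum 'I_n -> true -> 0 <= x 0 i * x 0 i.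
  by rewrite -expr2 sqr_ge0.
move/eqP; rewrite /dot psumr_eq0 => [/allP x0|i _]; last by rewrite -expr2 sqr_ge0.
apply/eqP/rowP => i; rewrite mxE; apply/eqP.
by have := x0 i (mem_index_enum _); rewrite mulf_eq0 orbb.
Qed.

(** The weight [1 + |x|^2]; its powers have no zeros, hence may be denominators of regular
    functions. *)
Definition energy x := 1 + dot x x.

Lemma energy_ge1 x : 1 <= energy x.
Proof. by rewrite lerDl dot_ge0. Qed.

Lemma polyfun_dot a : polyfun (dot a).
Proof.
by apply: (@fun_class_sum _ _ false) => i; apply: polyfunM;
  [exact: polyfun_cst | exact: polyfun_coord].
Qed.

Lemma polyfun_energy : polyfun energy.
Proof.
apply: polyfunD; first exact: polyfun_cst.
by apply: (@fun_class_sum _ _ false) => i; apply: polyfunM; exact: polyfun_coord.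
Qed.

Lemma coord_le_energy x i : `|x 0 i| <= energy x.
Proof.
have : x 0 i * x 0 i <= dot x x.
  by rewrite /dot (bigD1 i) //= lerDl; apply: sumr_ge0 => j _; rewrite -expr2 sqr_ge0.
by rewrite /energy -expr2 -real_normK ?num_real // => H; nra.
Qed.

Lemma continuous_line F x v : polyfun F -> continuous (fun t : R => F (x + t *: v)).
Proof.
move: F; apply: peval_ind => [c|i|F G cF cG|F G cF cG] t.
- exact: cvg_cst.
- rewrite (_ : (fun _ => _) = fun s => x 0 i + s * v 0 i); last first.
    by apply/funext => s; rewrite !mxE.
  apply: cvgD; first exact: cvg_cst.
  by apply: cvgM; [exact: cvg_id | exact: cvg_cst].
- by apply: cvgD; [exact: cF | exact: cG].
- by apply: cvgM; [exact: cF | exact: cG].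
Qed.

Lemma power_bounded_poly (T : Type) (D : set T) (w : T -> R) F (g : T -> 'rV[R]_n) :
  (forall z, D z -> 1 <= w z) -> polyfun F ->
  (forall i, power_bounded D w (fun z => g z 0 i)) ->
  power_bounded D w (fun z => F (g z)).
Proof.
move=> w1 pF bg; move: F pF.
apply: (@peval_ind _ _ (fun F => power_bounded D w (fun z => F (g z)))) => [c|i|F G|F G].
- exact: power_bounded_cst.
- exact: bg.
- exact: power_boundedD.
- exact: power_boundedM.
Qed.

(** [P] is the difference quotient of [F] along [v]; of its polynomial nature only the growth along
    power bounded arguments is recorded. *)
Lemma line_increment (T : Type) (D : set T) (w : T -> R) F v :
  (forall z, D z -> 1 <= w z) -> polyfun F ->
  exists2 P : 'rV[R]_n -> R -> R, forall x s, F (x + s *: v) = F x + s * P x s &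
    forall (g : T -> 'rV[R]_n) u, (forall i, power_bounded D w (fun z => g z 0 i)) ->
      power_bounded D w u -> power_bounded D w (fun z => P (g z) (u z)).
Proof.
(* The induction also carries [polyfun], since the quotient of a product involves the values of the
   factors. *)
move=> w1 pF; suff [] : polyfun F /\
  exists2 P : 'rV[R]_n -> R -> R, forall x s, F (x + s *: v) = F x + s * P x s &
    forall (g : T -> 'rV[R]_n) u, (forall i, power_bounded D w (fun z => g z 0 i)) ->
      power_bounded D w u -> power_bounded D w (fun z => P (g z) (u z)) by [].
move: F pF; apply: peval_ind => [c|i|F G [pF [P FP bP]] [pG [Q GQ bQ]]|
  F G [pF [P FP bP]] [pG [Q GQ bQ]]].
- split; first exact: polyfun_cst.
  exists (fun _ _ => 0) => [x s|g u _ _]; first by rewrite mulr0 addr0.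
  exact: power_bounded_cst.
- split; first exact: polyfun_coord.
  exists (fun _ _ => v 0 i) => [x s|g u _ _]; first by rewrite !mxE.
  exact: power_bounded_cst.
- split; first exact: polyfunD.
  exists (fun x s => P x s + Q x s) => [x s|g u bg bu]; first by rewrite FP GQ; ring.
  by apply: power_boundedD => //; [exact: bP | exact: bQ].
split; first exact: polyfunM.
exists (fun x s => (F x + s * P x s) * Q x s + G x * P x s) => [x s|g u bg bu].
  by rewrite FP GQ; ring.
have bFP := power_boundedM bu (bP g u bg bu).
have bF := power_bounded_poly w1 pF bg; have bG := power_bounded_poly w1 pG bg.
apply: power_boundedD => //; apply: power_boundedM => //; try exact: bQ; try exact: bP.
exact: power_boundedD.
Qed.

End Dot.

(** * Trimming maps *)

Section Trim.
Variables (R : realType) (n : nat).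
Implicit Types (C S : set 'rV[R]_n) (q h E tau F : 'rV[R]_n -> R).
Implicit Types (x y v a : 'rV[R]_n) (s t b c : R).

(* With these bounds at an end [b] of a fibre, the denominator [D = 4 E^5] of
   [Q = q^2 / D] is large enough for both kinds of trimming maps. *)
Definition controls (E : R) q h v x b := forall t, `|t| <= `|b| ->
  [/\ `|h x| <= E, `|t| <= E, q (x + t *: v) ^+ 2 <= E &
      q (x + t *: v) ^+ 2 <= E * `|t - b|].

(** With [b] and [t] bounded by a power of [energy x], all quantities in [controls] grow at most
    like such a power. The bound by [E * |t - b|] holds because [b] is a root: [q] is [t - b] times
    a difference quotient, and one of the two factors of [q ^+ 2] is rewritten so. *)
Lemma power_controls q h v A0 k0 : polyfun q -> polyfun h ->
  exists A k, 1 <= A /\ forall x b, q (x + b *: v) = 0 ->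
    `|b| <= A0 * energy x ^+ k0 -> controls (A * energy x ^+ k) q h v x b.
Proof.
move=> pq ph.
pose T := ('rV[R]_n * R * R)%type.
(* Triples [(x, b, t)], weighted by the energy of [x] alone. *)
pose D : set T := [set z | `|z.1.2| <= A0 * energy z.1.1 ^+ k0 /\ `|z.2| <= `|z.1.2|].
pose w (z : T) := energy z.1.1.
have w1 z : D z -> 1 <= w z by move=> _; exact: energy_ge1.
have bx i : power_bounded D w (fun z => z.1.1 0 i).
  apply: power_bounded_le (power_bounded_weight w1) _ => z /w1 wz.
  by rewrite [leRHS]ger0_norm ?coord_le_energy //; lra.
have bb : power_bounded D w (fun z => z.1.2).
  apply: (@power_bounded_le _ _ _ _ _ (fun z => A0 * w z ^+ k0)) => [|z [zb _]].
    apply: power_boundedM => //; first exact: power_bounded_cst.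
    by apply: power_boundedX => //; exact: power_bounded_weight.
  exact: le_trans zb (ler_norm _).
have bt : power_bounded D w (fun z => z.2).
  by apply: power_bounded_le bb _ => z [_].
have bshift u : power_bounded D w u ->
    forall i, power_bounded D w (fun z : T => (z.1.1 + u z *: v) 0 i).
  move=> bu i; rewrite (_ : (fun _ => _) = fun z : T => z.1.1 0 i + u z * v 0 i); last first.
    by apply/funext => z; rewrite !mxE.
  by apply: power_boundedD => //; apply: power_boundedM => //; exact: power_bounded_cst.
have [P qP bP] := line_increment v w1 pq.
have bdt : power_bounded D w (fun z : T => z.2 - z.1.2).
  by apply: power_boundedD => //; apply: power_bounded_le bb _ => z _; rewrite normrN.
have bq := power_bounded_poly w1 pq (bshift _ bt).
have bqP := power_boundedM bq (bP _ _ (bshift _ bb) bdt).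
have bh := power_bounded_poly w1 ph bx.
(* Four nonnegative quantities are summed, so that one pair [A], [k] bounds each of them. *)
have := power_boundedD w1 (power_bounded_norm bqP) (power_boundedX 2 bq).
move=> /(power_boundedD w1 (power_bounded_norm bh))/(power_boundedD w1 (power_bounded_norm bt)).
move=> [A [k [A0' H]]]; exists (1 + A), k; split; first lra.
move=> x b qb bA t tb; have /= := H (x, b, t) (conj bA tb).
set Y := `|q _ * P _ _|; set Q2 := q _ ^+ 2; set X := _ ^+ k.
have X1 : 1 <= X by apply: exprn_ege1; exact: energy_ge1.
have Y0 : 0 <= Y by exact: normr_ge0.
have Q0 : 0 <= Q2 by exact: sqr_ge0.
have h0 := normr_ge0 (h x); have t0 := normr_ge0 t.
rewrite ger0_norm; last by lra.
move=> HA; have AX : (1 + A) * X = X + A * X by ring.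
rewrite AX; split; try lra.
have -> : Q2 = Y * `|t - b|.
  rewrite /Q2 /Y -normrM -mulrA [P _ _ * _]mulrC.
  have -> : (t - b) * P (x + b *: v) (t - b) = q (x + t *: v).
    by have := qP (x + b *: v) (t - b); rewrite qb add0r -addrA -scalerDl subrKC.
  by rewrite -expr2 ger0_norm // sqr_ge0.
by apply: ler_wpM2r => //; lra.
Qed.

(** As [tau] is a coordinate along [v], each line in this direction has exactly one point with
    [tau = 0]. With that base point the parameter [t] equals [tau], and the sets are compared line
    by line. *)
Lemma image_along_lines v tau F S S' :
  (forall x t, tau (x + t *: v) = tau x + t) ->
  (forall x (y : R), tau x = 0 ->
     (exists2 t, S (x + t *: v) & t + F (x + t *: v) = y) <-> S' (x + y *: v)) ->
  (fun x => x + F x *: v) @` S = S'.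
Proof.
move=> tauv H; have base z : tau (z - tau z *: v) = 0.
  by rewrite -scaleNr tauv subrr.
apply/seteqP; split=> [_ [z Sz <-]|z S'z].
  rewrite -{1}[z](subrK (tau z *: v)) -addrA -scalerDl.
  by apply/(H _ _ (base z)); exists (tau z); rewrite subrK.
have [_] := H _ (tau z) (base z); rewrite subrK => /(_ S'z) [t St tz].
by exists (z - tau z *: v + t *: v) => //; rewrite -addrA -scalerDl tz subrK.
Qed.

Definition fiber C v x := [set t | C (x + t *: v)].

Definition grows (g : R -> R) := forall M, exists T, forall t, T <= `|t| -> M <= `|g t|.

Lemma grows_sqr_div g d : 0 < d -> grows g -> tends_to_infty (fun t => g t ^+ 2 / d) /\
  tends_to_infty (fun t => g (- t) ^+ 2 / d).
Proof.
move=> d0 gg; suff H M : exists T, forall t, T <= `|t| -> M <= g t ^+ 2 / d.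
  split=> M; have [T HT] := H M; exists T => t Tt; apply: HT; last rewrite normrN;
    exact: le_trans Tt (ler_norm _).
have [T HT] := gg (Num.max 1 (M * d)); exists T => t /HT.
rewrite ge_max ler_pdivlMr // => /andP[g1 gM].
rewrite -[g t ^+ 2]ger0_norm ?sqr_ge0 // normrX; nra.
Qed.

Lemma ends_at_zeros_sqr_div I (g : R -> R) d : 0 < d ->
  ends_at_zeros I g -> ends_at_zeros I (fun t => g t ^+ 2 / d).
Proof.
move=> d0 [iI H]; split=> // b Ib; rewrite mulf_eq0 sqrf_eq0 negb_or => /andP[gb _].
exact: H.
Qed.

Lemma sqr_div_eq0 (g d : R) : 0 < d -> g ^+ 2 / d = 0 -> g = 0.
Proof. by move=> d0 /eqP; rewrite mulf_eq0 sqrf_eq0 invr_eq0 (gt_eqF d0) orbF => /eqP. Qed.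

Lemma fun_classV_pow5 reg E : fun_class reg (fun x => (E x)^-1) ->
  fun_class reg (fun x => (4 * E x ^+ 5)^-1).
Proof.
move=> cE; rewrite (_ : (fun _ => _) = fun x => 4^-1 * (E x)^-1 ^+ 5).
  by apply: fun_classM; [exact: fun_class_cst | exact: fun_classX].
by apply/funext => x; rewrite invfM exprVn.
Qed.

Lemma map_class_along reg v F : fun_class reg F ->
  map_class reg (fun x => x + F x *: v).
Proof.
move=> cF j; rewrite (_ : (fun _ => _) = fun x => x 0 j + F x * v 0 j).
  apply: fun_classD; first exact: fun_class_coord.
  by apply: fun_classM => //; exact: fun_class_cst.
by apply/funext => x; rewrite !mxE.
Qed.

(** [E] and [h] are constant along [v], so each line undergoes a stretch with [eta = h x] and
    [Q = q^2 / D]; the sign of [h x] makes it expanding, reversing or the identity. Accordingly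
    [controls] is asked where [h < 0], and bounded fibres where [h > 0]. *)
Lemma trim_parallel reg C v tau h q E :
  polyfun q -> polyfun h -> fun_class reg tau ->
  fun_class reg (fun x => (E x)^-1) -> (forall x, 1 <= E x) ->
  (forall x t, tau (x + t *: v) = tau x + t) ->
  (forall x t, h (x + t *: v) = h x) -> (forall x t, E (x + t *: v) = E x) ->
  (forall x, tau x = 0 -> h x != 0 ->
     ends_at_zeros (fiber C v x) (fun t => q (x + t *: v))) ->
  (forall x, tau x = 0 -> 0 < h x ->
     grows (fun t => q (x + t *: v)) /\ exists B, forall t, fiber C v x t -> `|t| <= B) ->
  (forall x b, tau x = 0 -> h x < 0 -> line_adherent (fiber C v x) b ->
     q (x + b *: v) = 0 -> controls (E x) q h v x b) ->
  is_image reg (~` C) -> is_image reg (~` (C `&` [set x | h x <= 0])).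
Proof.
move=> pq ph ctau cE E1 tauv hv Ev ends pos neg iC.
pose D x := 4 * E x ^+ 5.
have D0 x : 0 < D x by rewrite mulr_gt0 // exprn_gt0 // (lt_le_trans ltr01).
pose F x := - (h x * tau x * (q x ^+ 2 / D x)).
apply: (is_image_map iC (f := fun x => x + F x *: v)).
  apply: map_class_along; apply: fun_classN; apply: fun_classM.
    by apply: fun_classM => //; exact: polyfun_class.
  apply: fun_classM; first by apply: fun_classX; exact: polyfun_class.
  exact: fun_classV_pow5.
apply: (image_along_lines tauv) => x y tx; have Dx := D0 x.
pose I := fiber C v x; pose Q t := q (x + t *: v) ^+ 2 / D x.
have FE t : t + F (x + t *: v) = t - h x * t * Q t.
  by rewrite /F hv tauv tx add0r /Q /D Ev.
have Q0 t : 0 <= Q t by rewrite divr_ge0 ?sqr_ge0 // ltW.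
have cQ : continuous Q.
  move=> t; apply: cvgM; last exact: cvg_cst.
  by apply: cvgM; apply: continuous_line.
suff : (exists2 t, ~ I t & t - h x * t * Q t = y) <-> ~ (I y /\ h x <= 0).
  move=> H; rewrite /= hv; split=> [[t It ty]|/H[t It ty]].
    by apply/H; exists t => //; rewrite -FE.
  by exists t => //; rewrite FE.
case: (ltgtP (h x) 0) => hx.
- have IQ : ends_at_zeros I Q by apply: ends_at_zeros_sqr_div => //; apply: ends; rewrite ?lt_eqF.
  rewrite (_ : (_ /\ true) = I y); last by apply/propext; split=> [[]|].
  apply: expanding_stretch => // b t Ib /(sqr_div_eq0 Dx) qb bt.
  have [|hE tE qE qEb] := neg x b tx hx Ib qb t.
    case/orP: bt => /andP[? ?]; first by rewrite !ler0_norm //; lra.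
    by rewrite !ger0_norm //; lra.
  have d0 : 0 < `|t - b|.
    by rewrite normr_gt0 subr_eq0; apply/eqP => e; move: bt; rewrite e ltxx andbF.
  rewrite mulrA ltr_pdivrMr // -(ltr0_norm hx) /D.
  (* [controls] bounds the left side by [E^3 |t - b|], strictly below [4 E^5 |t - b|]. *)
  apply: (@le_lt_trans _ _ (E x * E x * (E x * `|t - b|))).
    have hht : `|h x| * `|t| <= E x * E x by apply: ler_pM.
    by apply: ler_pM => //; exact: sqr_ge0.
  have E0 := E1 x; have E5 : E x ^+ 3 <= E x ^+ 5 by apply: ler_weXn2l.
  have : 0 < E x ^+ 3 by apply: exprn_gt0; lra.
  move=> E3; rewrite -subr_gt0 (_ : _ - _ = (4 * E x ^+ 5 - E x ^+ 3) * `|t - b|); last by ring.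
  by rewrite mulr_gt0 //; lra.
- have IQ : ends_at_zeros I Q by apply: ends_at_zeros_sqr_div => //; apply: ends; rewrite ?gt_eqF.
  have [gq [B IB]] := pos x tx hx; have [Qp Qm] := grows_sqr_div Dx gq.
  split=> [_ []//|_]; exact: (reversing_stretch cQ Q0 IQ _ hx IB).
rewrite hx; split=> [[t nIt <-]|H].
  by rewrite mul0r mul0r subr0 => -[].
by exists y; [move=> Iy; apply: H | rewrite !mul0r subr0].
Qed.

(** Here [tau] is both the line coordinate and the constraint being added, and each line undergoes
    the dipping stretch; [controls] is asked at negative upper ends. *)
Lemma trim_transverse reg C v tau q E :
  polyfun q -> fun_class reg tau ->
  fun_class reg (fun x => (E x)^-1) -> (forall x, 1 <= E x) ->
  (forall x t, tau (x + t *: v) = tau x + t) -> (forall x t, E (x + t *: v) = E x) ->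
  (forall x, tau x = 0 ->
     ends_at_zeros (fiber C v x) (fun t => q (x + t *: v))) ->
  (forall x, tau x = 0 ->
     grows (fun t => q (x + t *: v)) /\ exists B, forall t, fiber C v x t -> t <= B) ->
  (forall x b, tau x = 0 -> line_adherent (fiber C v x) b ->
     (forall r, fiber C v x r -> r <= b) -> b < 0 ->
     q (x + b *: v) = 0 -> controls (E x) q (fun=> 0) v x b) ->
  is_image reg (~` C) -> is_image reg (~` (C `&` [set x | tau x < 0])).
Proof.
move=> pq ctau cE E1 tauv Ev ends pos neg iC.
pose D x := 4 * E x ^+ 5.
have D0 x : 0 < D x by rewrite mulr_gt0 // exprn_gt0 // (lt_le_trans ltr01).
pose F x := tau x * (1 - tau x * (q x ^+ 2 / D x)) ^+ 2 - tau x.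
apply: (is_image_map iC (f := fun x => x + F x *: v)).
  apply: map_class_along; apply: fun_classB => //; apply: fun_classM => //.
  apply: fun_classX; apply: fun_classB; first exact: fun_class_cst.
  apply: fun_classM => //; apply: fun_classM; first by apply: fun_classX; exact: polyfun_class.
  exact: fun_classV_pow5.
apply: (image_along_lines tauv) => x y tx; have Dx := D0 x.
pose I := fiber C v x; pose Q t := q (x + t *: v) ^+ 2 / D x.
have FE t : t + F (x + t *: v) = t * (1 - t * Q t) ^+ 2.
  by rewrite /F tauv tx add0r /Q /D Ev addrC subrK.
have Q0 t : 0 <= Q t by rewrite divr_ge0 ?sqr_ge0 // ltW.
have cQ : continuous Q.
  move=> t; apply: cvgM; last exact: cvg_cst.
  by apply: cvgM; apply: continuous_line.
suff : (exists2 t, ~ I t & t * (1 - t * Q t) ^+ 2 = y) <-> ~ (I y /\ y < 0).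
  move=> H; rewrite /= tauv tx add0r; split=> [[t It ty]|/H[t It ty]].
    by apply/H; exists t => //; rewrite -FE.
  by exists t => //; rewrite FE.
have IQ : ends_at_zeros I Q by apply: ends_at_zeros_sqr_div => //; apply: ends.
have [gq IB] := pos x tx; have [Qp _] := grows_sqr_div Dx gq.
apply: dipping_stretch => // b t Ib ub /(sqr_div_eq0 Dx) qb /andP[bt t0].
have [|_ tE qE qEb] := neg x b tx Ib ub (lt_trans bt t0) qb t.
  by rewrite !ltr0_norm //; lra.
rewrite ltr0_norm // in tE; rewrite gtr0_norm ?subr_gt0 // in qEb.
have e1 := E1 x; set e := E x in tE qE qEb e1.
have Qe : Q t * (4 * e ^+ 5) = q (x + t *: v) ^+ 2 by rewrite /Q /D divfK // gt_eqF.
rewrite -Qe in qE qEb; move: (Q t) (Q0 t) qE qEb => u u0 ue ud.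
have e2 : 1 <= e ^+ 2 by apply: exprn_ege1.
have e4 : 1 <= e ^+ 4 by apply: exprn_ege1.
have e0 : 0 < e by lra.
have ud4 : 4 * u * e ^+ 4 <= t - b.
  by rewrite -(ler_pM2l e0); apply: le_trans ud; rewrite le_eqVlt; apply/orP; left; apply/eqP; ring.
have u4 : 4 * u * e ^+ 4 <= 1.
  by rewrite -(ler_pM2l e0) mulr1; apply: le_trans ue; rewrite le_eqVlt; apply/orP; left; apply/eqP; ring.
(* Both [t^2 u] and [- t u] are at most [w], while [4 w] is at most 1 and at most [t - b]. The
   displacement [2 t^2 u + (t^2 u)(- t u)] is thus at most [3 w], less than [t - b]. *)
pose w := e ^+ 2 * u.
have w0 : 0 <= w by rewrite mulr_ge0 // exprn_ge0 // ltW.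
have w4 : 4 * w <= 4 * u * e ^+ 4.
  rewrite (_ : 4 * u * _ = 4 * w * e ^+ 2); last by rewrite /w; ring.
  by rewrite ler_peMr //; lra.
have S0 : 0 < - t by lra.
have Se : (- t) ^+ 2 <= e ^+ 2 by rewrite ler_sqr ?nnegrE //; lra.
have Suw : (- t) ^+ 2 * u <= w by apply: ler_wpM2r.
have Su : - t * u <= w.
  by apply: ler_wpM2r => //; apply: le_trans tE _; rewrite -[leLHS]expr1 ler_weXn2l.
have Su0 : 0 <= - t * u by rewrite mulr_ge0 // ltW.
have Suu0 : 0 <= (- t) ^+ 2 * u by rewrite mulr_ge0 // sqr_ge0.
have SS : ((- t) ^+ 2 * u) * (- t * u) <= w * w by apply: ler_pM.
rewrite (_ : - t * _ = 2 * ((- t) ^+ 2 * u) + ((- t) ^+ 2 * u) * (- t * u)); last by ring.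
have ww : w * w <= w by rewrite -[leRHS]mulr1; apply: ler_wpM2l => //; lra.
by lra.
Qed.

End Trim.

(** * Systems of affine constraints *)

Section Regions.
Variables (R : realType) (n : nat).
Implicit Types (q : 'rV[R]_n -> R) (x y z v w a : 'rV[R]_n) (t b c r : R).

(** Normal vector, constant term, and whether the inequality is strict. *)
Definition constraint := ('rV[R]_n * R * bool)%type.
Implicit Types (k : constraint) (s : seq constraint).

Definition affine k x := dot k.1.1 x + k.1.2.

Definition satisfies k x := if k.2 then affine k x < 0 else affine k x <= 0.

Definition region q s := [set x | q x < 0 /\ all (satisfies^~ x) s].

(** Vanishes at the ends of all fibres along [v]. Constraints constant along [v] are left out: they
    create no end, and a factor vanishing on a whole line would destroy the growth. *)
Definition region_poly q s v x := q x * \prod_(k <- s | dot k.1.1 v != 0) affine k x.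

Lemma polyfun_affine k : polyfun (affine k).
Proof. by apply: polyfunD; [exact: polyfun_dot | exact: polyfun_cst]. Qed.

Lemma polyfun_region_poly q s v : polyfun q -> polyfun (region_poly q s v).
Proof.
move=> pq; apply: polyfunM => //; apply: (@fun_class_prod _ _ false) => k.
exact: polyfun_affine.
Qed.

Lemma affine_line k x t v : affine k (x + t *: v) = affine k x + t * dot k.1.1 v.
Proof. by rewrite /affine dotDr dotZr addrAC. Qed.

Lemma satisfies_le0 k x : satisfies k x -> affine k x <= 0.
Proof. by rewrite /satisfies; case: k.2 => // /ltW. Qed.

Lemma lt0_satisfies k x : affine k x < 0 -> satisfies k x.
Proof. by rewrite /satisfies; case: k.2 => // /ltW. Qed.

Lemma line_interior_lt0 (g : R -> R) b : continuous g -> g b < 0 ->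
  line_interior [set t | g t < 0] b.
Proof.
move=> cg gb; have e0 : 0 < - g b by lra.
have /cvgrPdist_lt/(_ _ e0)/nbhs_ballP[e /= e1 H] := cg b.
exists e => // r rb; have := H r; rewrite /ball /= distrC => /(_ rb).
by rewrite ltr_norml; lra.
Qed.

Lemma line_adherent_le0 (g : R -> R) I b : continuous g -> line_adherent I b ->
  (forall t, I t -> g t <= 0) -> g b <= 0.
Proof.
move=> cg Ib gI; rewrite leNgt; apply/negP => gb.
have [||e e0 H] := @line_interior_lt0 (fun t => - g t) b.
- by move=> t; apply: cvgN; exact: cg.
- lra.
have [r /gI gr /H] := Ib e e0; rewrite /=; lra.
Qed.

(** Where [region_poly] is nonzero, every inequality varying along [v] is strict at an adherent
    point, hence persists nearby; one that is constant along [v] holds on the whole line. *)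
Lemma ends_at_zeros_region q s v x : polyfun q ->
  is_interval [set t | q (x + t *: v) < 0] ->
  ends_at_zeros (fiber (region q s) v x) (fun t => region_poly q s v (x + t *: v)).
Proof.
move=> pq iq; split=> [y z [qy sy] [qz sz] t tyz|b Ib].
  split; first exact: (iq y z).
  apply/allP => k ks; have := allP sy k ks; have := allP sz k ks.
  case/andP: tyz => yt tz.
  have : t * dot k.1.1 v <= z * dot k.1.1 v \/ t * dot k.1.1 v <= y * dot k.1.1 v.
    have [d0|d0] := leP 0 (dot k.1.1 v); [left; exact: ler_wpM2r|right].
    by apply: ler_wnM2r => //; exact: ltW.
  by rewrite /satisfies !affine_line; case: k.2; lra.
rewrite mulf_eq0 negb_or => /andP[qb sb].
have qint : line_interior [set t | q (x + t *: v) < 0] b.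
  apply: line_interior_lt0; first exact: (continuous_line pq).
  rewrite lt_neqAle qb /=.
  by apply: (line_adherent_le0 (continuous_line pq) Ib) => t [/ltW].
have kint k : k \in s -> line_interior [set t | satisfies k (x + t *: v)] b.
  move=> ks; have [kv|kv] := eqVneq (dot k.1.1 v) 0.
    exists 1 => // r _; have [t [_ /allP/(_ _ ks) sat] _] := Ib 1 ltr01.
    by move: sat; rewrite /= /satisfies !affine_line kv !mulr0.
  have ck : continuous (fun t => affine k (x + t *: v)).
    exact: continuous_line (polyfun_affine k).
  have [|e e0 H] := line_interior_lt0 (b := b) ck.
    rewrite lt_neqAle; apply/andP; split.
      apply: contra sb => kb; rewrite prodf_seq_eq0.
      by apply/hasP; exists k; rewrite ?kv.
    apply: (line_adherent_le0 ck Ib) => t [_ /allP/(_ _ ks)].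
    exact: satisfies_le0.
  by exists e => // r /H/lt0_satisfies.
have [e e0 qe] := qint.
suff [d d0 H] : line_interior [set t | all (satisfies^~ (x + t *: v)) s] b.
  exists (Num.min e d); first by rewrite lt_min e0.
  by move=> r; rewrite lt_min => /andP[/qe ? /H ?].
elim: s kint {Ib sb} => [|k s IH] kint; first by exists 1.
have [|d d0 H] := IH; first by move=> k' k's; apply: kint; rewrite inE k's orbT.
have [|d' d'0 H'] := kint k; first by rewrite inE eqxx.
exists (Num.min d d'); first by rewrite lt_min d0.
by move=> r; rewrite lt_min => /andP[/H ? /H' ?]; apply/andP; split.
Qed.

(** The root is [- affine k x / dot k.1.1 v], of polynomial growth in [x]; a sum over [s] bounds the
    roots of all constraints at once. *)
Lemma region_poly_root_bound s v : exists A j, forall x b,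
  (exists2 k, k \in s & dot k.1.1 v != 0 /\ affine k (x + b *: v) = 0) ->
  `|b| <= A * energy x ^+ j.
Proof.
pose F x := \sum_(k <- s) `|affine k x * (dot k.1.1 v)^-1|.
have w1 x : [set: 'rV[R]_n] x -> 1 <= energy x by move=> _; exact: energy_ge1.
have [A [j [A0 H]]] : power_bounded setT (@energy R n) F.
  rewrite {}/F; elim: s => [|k s IH].
    rewrite (_ : (fun _ => _) = fun=> 0); first exact: power_bounded_cst.
    by apply/funext => x; rewrite big_nil.
  rewrite (_ : (fun _ => _) = fun x => `|affine k x * (dot k.1.1 v)^-1| +
    \sum_(k <- s) `|affine k x * (dot k.1.1 v)^-1|); last first.
    by apply/funext => x; rewrite big_cons.
  apply: power_boundedD => //; apply: power_bounded_norm; apply: power_boundedM.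
    apply: (power_bounded_poly w1 (polyfun_affine k)) => i.
    apply: power_bounded_le (power_bounded_weight w1) _ => x _.
    by apply: le_trans (coord_le_energy x i) (ler_norm _).
  exact: power_bounded_cst.
exists A, j => x b [k ks [kv]]; rewrite affine_line => kb.
apply: le_trans (le_trans (ler_norm _) (H x I)).
have -> : b = - (affine k x * (dot k.1.1 v)^-1).
  by apply: (mulIf kv); rewrite mulNr divfK //; lra.
rewrite normrN /F; elim: s ks {F H} => [//|k' s IH]; rewrite inE big_cons => /orP[/eqP ->|/IH Hs].
  by rewrite lerDl; apply: sumr_ge0.
by apply: le_trans Hs _; rewrite lerDr.
Qed.

Lemma region_poly_eq0 q s v x : region_poly q s v x = 0 -> q x != 0 ->
  exists2 k, k \in s & dot k.1.1 v != 0 /\ affine k x = 0.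
Proof.
move=> /eqP; rewrite mulf_eq0 => /orP[-> //|]; rewrite prodf_seq_eq0 => /hasP[k ks /andP[kv /eqP kx]] _.
by exists k.
Qed.

Definition eventually_ge1 (g : R -> R) := exists T, forall t, T <= `|t| -> 1 <= `|g t|.

Lemma grows_ge1 g : grows g -> eventually_ge1 g.
Proof. by apply. Qed.

Lemma grows_affine k x v : dot k.1.1 v != 0 -> grows (fun t => affine k (x + t *: v)).
Proof.
move=> kv M; exists ((`|M| + `|affine k x|) / `|dot k.1.1 v|) => t.
rewrite ler_pdivrMr ?normr_gt0 // affine_line [affine k x + _]addrC -normrM => H.
have := lerB_normD (t * dot k.1.1 v) (affine k x).
by have := ler_norm M; lra.
Qed.

Lemma growsMr g g' : grows g -> eventually_ge1 g' -> grows (fun t => g t * g' t).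
Proof.
move=> gg [T' g'1] M; have [T HT] := gg `|M|; exists (Num.max T T') => t.
rewrite ge_max normrM => /andP[/HT Mg /g'1 g1].
by have := ler_norm M; have := normr_ge0 M; nra.
Qed.

Lemma growsMl g g' : eventually_ge1 g -> grows g' -> grows (fun t => g t * g' t).
Proof.
move=> g1 gg'; rewrite (_ : (fun _ => _) = fun t => g' t * g t); first exact: growsMr.
by apply/funext => t; rewrite mulrC.
Qed.

(** Every affine factor kept is nonconstant on the line and grows, so one growing factor suffices:
    [q], or some constraint when [q] is eventually at least 1 in size. *)
Lemma grows_region_poly q s v x :
  grows (fun t => q (x + t *: v)) \/
    eventually_ge1 (fun t => q (x + t *: v)) /\ (exists2 k, k \in s & dot k.1.1 v != 0) ->
  grows (fun t => region_poly q s v (x + t *: v)).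
Proof.
pose P s t := \prod_(k <- s | dot k.1.1 v != 0) affine k (x + t *: v).
have P1 s' : eventually_ge1 (P s').
  elim: s' => [|k s' IH].
    by exists 0 => t _; rewrite /P big_nil normr1.
  have [kv|kv] := eqVneq (dot k.1.1 v) 0.
    have [T HT] := IH; exists T => t; rewrite /P big_cons kv eqxx; exact: HT.
  have [T HT] := grows_ge1 (growsMr (grows_affine x kv) IH).
  by exists T => t /HT; rewrite /P big_cons kv.
case=> [gq|[q1 [k ks kv]]]; first exact: growsMr gq (P1 s).
apply: (growsMl q1).
elim: s ks => [//|k' s IH]; rewrite inE => /orP[/eqP <-|/IH gs].
  have gP := growsMr (grows_affine x kv) (P1 s).
  rewrite (_ : (fun _ => _) = fun t => affine k (x + t *: v) * P s t) //.
  by apply/funext => t; rewrite big_cons kv.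
have [k'v|k'v] := eqVneq (dot k'.1.1 v) 0.
  rewrite (_ : (fun _ => _) = fun t => P s t) //.
  by apply/funext => t; rewrite big_cons k'v eqxx.
rewrite (_ : (fun _ => _) = fun t => affine k' (x + t *: v) * P s t).
  exact: growsMl (grows_ge1 (grows_affine x k'v)) gs.
by apply/funext => t; rewrite big_cons k'v.
Qed.

End Regions.

(** * Quadratic and affine functions of one variable *)

Section Quadratic.
Variable R : realType.
Implicit Types a b c t : R.

Lemma is_interval_quadratic a b c : 0 <= a -> is_interval [set t | a * t ^+ 2 + b * t + c < 0].
Proof.
move=> a0 y z /= fy fz t /andP[yt tz].
have ayz : a * ((t - y) * (t - z)) <= 0 by rewrite mulr_ge0_le0 // mulr_ge0_le0 //; lra.
(* [a * (y + z) + b] is the slope of the chord over [[y, z]]; its sign tells which end value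
   dominates the value at [t]. *)
have [d0|d0] := leP 0 (a * (y + z) + b); nra.
Qed.

Lemma grows_quadratic a b c : a != 0 -> grows (fun t => a * t ^+ 2 + b * t + c).
Proof.
move=> a0 M; exists (Num.max 1 ((`|b| + `|c| + `|M|) / `|a|)) => t.
rewrite ge_max => /andP[t1]; rewrite ler_pdivrMr ?normr_gt0 // => tM.
have := lerB_normD (a * t ^+ 2) (b * t + c).
rewrite addrA [`|a * _|]normrM [`|t ^+ 2|]normrX => at2.
have := ler_normD (b * t) c; rewrite [`|b * t|]normrM => bt.
have := ler_norm M; have := normr_ge0 M; have := normr_ge0 c.
have : `|t| * (`|b| + `|c| + `|M|) <= `|t| * (`|t| * `|a|) by apply: ler_wpM2l.
nra.
Qed.

Lemma quadratic_ge0 a b c : 0 < a ->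
  exists T, forall t, T <= `|t| -> 0 <= a * t ^+ 2 + b * t + c.
Proof.
move=> a0; exists (Num.max 1 ((`|b| + `|c|) / a)) => t.
rewrite ge_max => /andP[t1]; rewrite ler_pdivrMr // => tM.
have := ler_norm (- (b * t)); rewrite normrN normrM => bt.
have := ler_norm (- c); rewrite normrN => cc; have := normr_ge0 c => c0.
have : `|t| * (`|b| + `|c|) <= `|t| * (`|t| * a) by apply: ler_wpM2l.
rewrite -(real_normK (num_real t)); nra.
Qed.

Lemma grows_linear b c : b != 0 -> grows (fun t => b * t + c).
Proof.
move=> b0 M; exists ((`|M| + `|c|) / `|b|) => t.
rewrite ler_pdivrMr ?normr_gt0 // => tM.
have := lerB_normD (b * t) c; rewrite normrM.
by have := ler_norm M; lra.
Qed.

End Quadratic.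

(** * Regular images *)

Section RegularTrimming.
Variables (R : realType) (n : nat).
Implicit Types (x y z v w a : 'rV[R]_n) (k : constraint R n) (s : seq (constraint R n)).

(** The constant [-1] makes the first inequality void. *)
Definition system s := region (fun=> -1) s.

Lemma normalized_direction a : a != 0 -> dot a ((dot a a)^-1 *: a) = 1.
Proof. by move=> a0; rewrite dotZr mulVf // gt_eqF // dot_gt0. Qed.

(** Split [a' = m *: a + p] with [p] nonzero and orthogonal to [a]; the coefficient of [p] in [w]
    then adjusts [dot a' w] freely. Along [w] a known constraint bounds the fibres while the new one
    increases. *)
Lemma common_direction a a' : a != 0 -> ~ (exists r, a' = r *: a) ->
  exists2 w, dot a w = 1 & dot a' w = 1.
Proof.
move=> a0 npar; have aa := dot_gt0 a0; have aa0 : dot a a != 0 by rewrite gt_eqF.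
pose m := dot a a' / dot a a; pose p := a' - m *: a.
have p0 : p != 0 by apply/eqP => /subr0_eq e; apply: npar; exists m.
have pp : dot p p != 0 by rewrite gt_eqF // dot_gt0.
have ap : dot a p = 0 by rewrite dotBr dotZr divfK // subrr.
have a'p : dot a' p = dot p p.
  by rewrite -[in LHS](subrK (m *: a) a') dotDl dotZl ap mulr0 addr0.
exists ((dot a a)^-1 *: a + ((1 - m) / dot p p) *: p).
  by rewrite dotDr !dotZr ap mulr0 addr0 mulVf.
by rewrite dotDr !dotZr a'p divfK // dotC mulrC subrKC.
Qed.

Lemma orthogonal_direction a : (1 < n)%N -> exists2 v, v != 0 & dot a v = 0.
Proof.
move=> n1; pose i0 := Ordinal (ltnW n1); pose i1 := Ordinal n1.
have i01 : i0 != i1 by [].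
have [a0|a0] := eqVneq (a 0 i0) 0.
  exists (delta_mx 0 i0); last by rewrite dot_delta.
  by apply/eqP => /rowP/(_ i0); rewrite !mxE !eqxx => /eqP; rewrite oner_eq0.
exists (a 0 i0 *: delta_mx 0 i1 - a 0 i1 *: delta_mx 0 i0).
  apply/eqP => /rowP/(_ i1); rewrite !mxE !eqxx eq_sym (negPf i01) /= mulr1 mulr0 subr0.
  by move/eqP; rewrite (negPf a0).
by rewrite dotBr !dotZr !dot_delta mulrC subrr.
Qed.

Lemma energy_line x v t :
  energy (x + t *: v) = dot v v * t ^+ 2 + 2 * dot x v * t + energy x.
Proof. by rewrite /energy !(dotDl, dotDr, dotZl, dotZr) [dot v x]dotC; ring. Qed.

Lemma grows_energy x v : v != 0 -> grows (fun t => energy (x + t *: v)).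
Proof.
move=> v0; rewrite (_ : (fun _ => _) = fun t => dot v v * t ^+ 2 + 2 * dot x v * t + energy x).
  by apply: grows_quadratic; rewrite gt_eqF // dot_gt0.
by apply/funext => t; rewrite energy_line.
Qed.

(** On each line the map is [tau |-> tau^2], with image the nonnegative half-line. This is the start
    of every carving. *)
Lemma image_above reg tau v : fun_class reg tau ->
  (forall x t, tau (x + t *: v) = tau x + t) ->
  is_image reg (~` [set x : 'rV[R]_n | tau x < 0]).
Proof.
move=> ctau tauv.
apply: (is_image_map (is_imageT R n reg) (f := fun x => x + (tau x ^+ 2 - tau x) *: v)).
  by apply: map_class_along; apply: fun_classB => //; exact: fun_classX.
apply: (image_along_lines tauv) => x y tx; rewrite /= tauv tx add0r.
split=> [[t _]|/negP]; first by rewrite tauv tx add0r subrKC => <-; apply/negP; rewrite -leNgt sqr_ge0.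
rewrite -leNgt => y0; exists (Num.sqrt y) => //.
by rewrite tauv tx add0r subrKC sqr_sqrtr.
Qed.

Lemma regfunV_energy_pow (A : R) j tau v : 1 <= A -> fun_class true tau ->
  regfun (fun x => (A * energy (x - tau x *: v) ^+ j)^-1).
Proof.
move=> A1 ctau; apply: regfunV => [|x]; last first.
  by rewrite gt_eqF // mulr_gt0 ?exprn_gt0 // ?(lt_le_trans ltr01) // energy_ge1.
apply: (@fun_classM _ _ true); first exact: (@fun_class_cst _ _ true).
apply: (@fun_classX _ _ true); apply: (@polyfun_comp _ _ true _ _ (polyfun_energy R n)).
rewrite (_ : (fun _ => _) = fun x => x + (- tau x) *: v).
  by apply: map_class_along; exact: (@fun_classN _ _ true).
by apply/funext => x; rewrite scaleNr.
Qed.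

(** The constraint [k] increases along [w]: it bounds every fibre from above and is a growing factor
    of [region_poly], as [trim_transverse] requires. The denominator depends only on the base point
    [x - tau x *: w] of the line. *)
Lemma regular_cut s k tau w : k \in s -> 0 < dot k.1.1 w ->
  regfun tau -> (forall x t, tau (x + t *: w) = tau x + t) ->
  is_image true (~` system s) -> is_image true (~` (system s `&` [set x | tau x < 0])).
Proof.
move=> ks kw ctau tauw; pose q := region_poly (fun=> -1) s w.
have pq : polyfun q by apply: polyfun_region_poly; exact: polyfun_cst.
have [A0 [i Ab]] := region_poly_root_bound s w.
have [A [j [A1 ctrl]]] := power_controls w A0 i pq (polyfun_cst n (0 : R)).
apply: (@trim_transverse _ _ true _ w tau q (fun x => A * energy (x - tau x *: w) ^+ j)) => //.
- exact: regfunV_energy_pow.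
- move=> x; rewrite -[leLHS]mulr1; apply: ler_pM; rewrite ?(le_trans ler01) //.
  by apply: exprn_ege1; exact: energy_ge1.
- by move=> x t; rewrite tauw [tau x + t]addrC scalerDl addrKA.
- move=> x tx; apply: ends_at_zeros_region; first exact: polyfun_cst.
  by move=> y z _ _ t _ /=; lra.
- move=> x tx; split.
    apply: grows_region_poly; right; split; last by exists k => //; rewrite gt_eqF.
    by exists 0 => t _; rewrite normrN normr1.
  exists (- affine k x / dot k.1.1 w) => t [_ /allP/(_ _ ks)/satisfies_le0].
  by rewrite affine_line ler_pdivlMr //; lra.
move=> x b tx _ _ _ qb; rewrite tx scale0r subr0; apply: ctrl => //.
by apply: Ab; apply: region_poly_eq0 qb _; rewrite oppr_eq0 oner_eq0.
Qed.

(** The inequality [h < 1 / energy x'] with its denominator cleared, where [h] is the affine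
    function of [k] and [x' = x - h *: w]. *)
Definition cut_poly k w x := affine k x * energy (x - affine k x *: w) - 1.

Lemma polyfun_cut_poly k w : polyfun (cut_poly k w).
Proof.
apply: polyfunD; last exact: polyfun_cst.
apply: polyfunM; first exact: polyfun_affine.
apply: (@polyfun_comp _ _ false _ _ (polyfun_energy R n)).
rewrite (_ : (fun _ => _) = fun x => x + (- affine k x) *: w).
  by apply: map_class_along; apply: (@fun_classN _ _ false); exact: polyfun_affine.
by apply/funext => x; rewrite scaleNr.
Qed.

(** Along [v], orthogonal to the normal of [k], the cut is quadratic in [t] with leading coefficient
    [h |v|^2]. For [h > 0] it makes the fibres bounded; for [h < 0] it is negative on the whole line
    and creates no end. *)
Lemma regular_trim_cut s k w : (1 < n)%N -> dot k.1.1 w = 1 ->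
  is_image true (~` region (cut_poly k w) s) ->
  is_image true (~` (region (cut_poly k w) s `&` [set x | affine k x <= 0])).
Proof.
move=> n1 kw; have [v v0 kv] := orthogonal_direction k.1.1 n1.
pose u := (dot v v)^-1 *: v; have uv : dot u v = 1 by rewrite dotC normalized_direction.
pose g := cut_poly k w; pose q := region_poly g s v.
have pg : polyfun g by exact: polyfun_cut_poly.
have pq : polyfun q by exact: polyfun_region_poly.
have [A0 [i Ab]] := region_poly_root_bound s v.
have [A [j [A1 ctrl]]] := power_controls v A0 i pq (polyfun_affine k).
have tauv x t : dot u (x + t *: v) = dot u x + t by rewrite dotDr dotZr uv mulr1.
have kline x t : affine k (x + t *: v) = affine k x by rewrite affine_line kv mulr0 addr0.
have gline x t : g (x + t *: v) =
    affine k x * energy (x - affine k x *: w + t *: v) - 1.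
  by rewrite /g /cut_poly kline addrAC.
pose e x t := energy (x - affine k x *: w + t *: v).
have gquad x t : g (x + t *: v) = affine k x * dot v v * t ^+ 2 +
    affine k x * (2 * dot (x - affine k x *: w) v) * t +
    (affine k x * energy (x - affine k x *: w) - 1).
  by rewrite gline energy_line; ring.
have gneg x t : affine k x < 0 -> g (x + t *: v) < 0.
  by move=> kx; rewrite gline; have := energy_ge1 (x - affine k x *: w + t *: v); nra.
apply: (@trim_parallel _ _ true _ v (dot u) (affine k) q
  (fun x => A * energy (x - dot u x *: v) ^+ j)) => //.
- exact: polyfun_affine.
- exact: polyfun_class (polyfun_dot u).
- by apply: regfunV_energy_pow => //; exact: (@polyfun_class _ _ true _ (polyfun_dot u)).
- move=> x; rewrite -[leLHS]mulr1; apply: ler_pM; rewrite ?(le_trans ler01) //.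
  by apply: exprn_ege1; exact: energy_ge1.
- by move=> x t; rewrite tauv [dot u x + t]addrC scalerDl addrKA.
- move=> x ux kx; apply: ends_at_zeros_region => //.
  have [kneg|kpos] := ltP (affine k x) 0.
    by move=> y z _ _ t _; exact: gneg.
  rewrite (_ : [set _ | _] = [set t | affine k x * dot v v * t ^+ 2 +
    affine k x * (2 * dot (x - affine k x *: w) v) * t +
    (affine k x * energy (x - affine k x *: w) - 1) < 0]).
    by apply: is_interval_quadratic; rewrite mulr_ge0 // dot_ge0.
  by apply/seteqP; split=> t /=; rewrite -/g gquad.
- move=> x ux kx; split.
    apply: grows_region_poly; left.
    rewrite (_ : (fun _ => _) = fun t => affine k x * dot v v * t ^+ 2 +
      affine k x * (2 * dot (x - affine k x *: w) v) * t +
      (affine k x * energy (x - affine k x *: w) - 1)).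
      by apply: grows_quadratic; rewrite gt_eqF // mulr_gt0 // dot_gt0.
    by apply/funext => t; exact: gquad.
  have [T HT] := grows_energy (x - affine k x *: w) v0 (1 / affine k x).
  exists T => t [gt _]; rewrite leNgt; apply/negP => /ltW/HT.
  move: gt; rewrite -/g gline ger0_norm; last by have := energy_ge1 (x - affine k x *: w + t *: v); lra.
  by rewrite ler_pdivrMr //; lra.
move=> x b ux kx _ qb; rewrite ux scale0r subr0; apply: ctrl => //.
by apply: Ab; apply: region_poly_eq0 qb _; rewrite lt_eqF //; exact: gneg.
Qed.

End RegularTrimming.

(** * Carving systems of constraints by regular maps *)

Section RegularSystems.
Variables (R : realType) (n : nat).
Hypothesis n1 : (1 < n)%N.
Implicit Types (x y z v w a : 'rV[R]_n) (k : constraint R n) (s : seq (constraint R n)).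

(* The height above the hypersurface [h = 1 / (1 + |x'|^2)], where [h] is the
   affine function of [k] and [x' = x - h(x) w]. *)
Definition cut_height k w x := affine k x - (energy (x - affine k x *: w))^-1.

Lemma cut_height_lt0 k w x : (cut_height k w x < 0) = (cut_poly k w x < 0).
Proof.
have e1 := energy_ge1 (x - affine k x *: w).
rewrite /cut_height /cut_poly !subr_lt0 -[_^-1]mul1r ltr_pdivlMr //.
by lra.
Qed.

Lemma cut_height_line k w x t : dot k.1.1 w = 1 ->
  cut_height k w (x + t *: w) = cut_height k w x + t.
Proof.
move=> kw; rewrite /cut_height affine_line kw mulr1 [affine k x + t]addrC.
by rewrite scalerDl addrKA -addrA addrC.
Qed.

Lemma regfun_cut_height k w : regfun (cut_height k w).
Proof.
apply: (@fun_classB _ _ true); first exact: (@polyfun_class _ _ true _ (polyfun_affine k)).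
have := @regfunV_energy_pow _ _ 1 1 (affine k) w (lexx _).
move=> /(_ (@polyfun_class _ _ true _ (polyfun_affine k))).
by congr regfun; apply/funext => x; rewrite mul1r expr1.
Qed.

Lemma region_cons q k s :
  region q (k :: s) = region q s `&` [set x | satisfies k x].
Proof. by apply/seteqP; split=> [x [qx /andP[kx sx]]|x [[qx sx] kx]]; split=> //; apply/andP. Qed.

(** The auxiliary cut leaves no trace: [h <= 0] implies [h < 1 / energy x'], so trimming by [h <= 0]
    yields exactly the enlarged system. *)
Lemma regular_nonstrict s k w : ~~ k.2 -> dot k.1.1 w = 1 ->
  is_image true (~` (system s `&` [set x | cut_height k w x < 0])) ->
  is_image true (~` system (k :: s)).
Proof.
move=> /negPf k2 kw; rewrite (_ : _ `&` _ = region (cut_poly k w) s); last first.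
  apply/seteqP; split=> [x [[_ sx]] /=|x [gx sx]].
    by rewrite cut_height_lt0 => gx; split.
  by split=> /=; [split=> //; lra | rewrite cut_height_lt0].
move/(regular_trim_cut n1 kw); congr (is_image true (~` _)).
rewrite /system region_cons; apply/seteqP; split=> [x [[gx sx] kx]|x [[_ sx]]].
  by split; [split=> //; lra | rewrite /= /satisfies k2].
rewrite /= /satisfies k2 => kx; split=> //; split=> //.
by rewrite /cut_poly; have := energy_ge1 (x - affine k x *: w); nra.
Qed.

Lemma regular_halfspace k : k.1.1 != 0 -> is_image true (~` system [:: k]).
Proof.
move=> k0; pose w := (dot k.1.1 k.1.1)^-1 *: k.1.1.
have kw : dot k.1.1 w = 1 by exact: normalized_direction.
have sysE : system [::] = [set: 'rV[R]_n] by apply/seteqP; split=> // x _; split=> //; lra.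
case k2 : (k.2).
  rewrite /system region_cons -/(system _) sysE setTI /satisfies k2.
  apply: (image_above (v := w)); first exact: polyfun_class (polyfun_affine k).
  by move=> x t; rewrite affine_line kw mulr1.
apply: (regular_nonstrict _ kw); rewrite ?k2 // sysE setTI.
apply: (image_above (v := w)); first exact: regfun_cut_height.
by move=> x t; exact: cut_height_line.
Qed.

Lemma regular_trim s k k' : k' \in s -> k.1.1 != 0 ->
  ~ (exists r, k'.1.1 = r *: k.1.1) ->
  is_image true (~` system s) -> is_image true (~` system (k :: s)).
Proof.
move=> k's k0 npar iS; have [w kw k'w] := common_direction k0 npar.
have k'w0 : 0 < dot k'.1.1 w by rewrite k'w.
case k2 : (k.2).
  rewrite /system region_cons -/(system _) /satisfies k2.
  apply: (regular_cut k's k'w0) => //; first exact: (@polyfun_class _ _ true _ (polyfun_affine k)).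
  by move=> x t; rewrite affine_line kw mulr1.
apply: (regular_nonstrict _ kw); rewrite ?k2 //.
apply: (regular_cut k's k'w0) => //; first exact: regfun_cut_height.
by move=> x t; exact: cut_height_line.
Qed.

Lemma region_absorb q s s' : {subset s' <= s} -> region q (s ++ s') = region q s.
Proof.
move=> ss; apply/seteqP; split=> x [qx sx]; split=> //.
  by move: sx; rewrite all_cat => /andP[].
by rewrite all_cat sx; apply/allP => k /ss; apply: (allP sx).
Qed.

(** Copies of [k1] and [k2] are put at the tail of the list, hence carved first. Every later normal
    is then nonparallel to at least one of theirs, as [regular_trim] requires. *)
Lemma regular_system s k1 k2 : (forall k, k \in s -> k.1.1 != 0) ->
  k1 \in s -> k2 \in s -> ~ (exists r, k2.1.1 = r *: k1.1.1) ->
  is_image true (~` system s).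
Proof.
move=> s0 k1s k2s npar; have k10 := s0 _ k1s; have k20 := s0 _ k2s.
have npar' : ~ exists r, k1.1.1 = r *: k2.1.1.
  move=> [r kr]; apply: npar; exists r^-1; rewrite kr scalerA mulVf ?scale1r //.
  by apply/eqP => r0; move: k10; rewrite kr r0 scale0r eqxx.
rewrite /system -(@region_absorb _ s [:: k2; k1]); last first.
  by move=> k; rewrite !inE => /orP[] /eqP ->.
suff H l : {subset l <= s} -> is_image true (~` system (l ++ [:: k2; k1])) by exact: H.
elim: l => [_|k l IH ls] /=.
  by apply: (@regular_trim _ k2 k1) => //; [rewrite inE eqxx | exact: regular_halfspace].
have {IH} iS : is_image true (~` system (l ++ [:: k2; k1])).
  by apply: IH => k' k'l; apply: ls; rewrite inE k'l orbT.
have k0 : k.1.1 != 0 by apply: s0; apply: ls; rewrite inE eqxx.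
have [[r kr]|nkr] := pselect (exists r, k1.1.1 = r *: k.1.1); last first.
  by apply: (@regular_trim _ k k1) => //; rewrite mem_cat !inE eqxx !orbT.
apply: (@regular_trim _ k k2) => //; first by rewrite mem_cat !inE eqxx !orbT.
move=> [r' kr']; apply: npar; exists (r' / r).
rewrite kr' kr scalerA divfK //.
by apply/eqP => r0; move: k10; rewrite kr r0 scale0r eqxx.
Qed.

End RegularSystems.

(** * Polynomial images *)

Section PolynomialSystems.
Variables (R : realType) (n : nat).
Hypothesis n1 : (1 < n)%N.
Implicit Types (x y z v w a : 'rV[R]_n) (k : constraint R n) (s : seq (constraint R n)).
Implicit Types (S : set 'rV[R]_n) (q h tau F : 'rV[R]_n -> R).

Definition energy_bounded S := exists M, forall x, S x -> energy x <= M.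

Lemma energy_boundedS S S' : S `<=` S' -> energy_bounded S' -> energy_bounded S.
Proof. by move=> SS [M HM]; exists M => x /SS/HM. Qed.

Lemma polyfun_bounded S F : energy_bounded S -> polyfun F ->
  exists B, forall x, S x -> `|F x| <= B.
Proof.
move=> [M HM] pF; have w1 x : S x -> 1 <= energy x by move=> _; exact: energy_ge1.
have [|A [j [A0 FA]]] := power_bounded_poly (g := id) w1 pF.
  move=> i; apply: power_bounded_le (power_bounded_weight w1) _ => x _.
  by apply: le_trans (coord_le_energy x i) (ler_norm _).
exists (A * M ^+ j) => x Sx; apply: le_trans (FA x Sx) _.
apply: ler_wpM2l => //; apply: lerXn2r; rewrite ?nnegrE ?HM //.
  by apply: le_trans (energy_ge1 x).
by apply: le_trans (HM x Sx); apply: le_trans (energy_ge1 x).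
Qed.

Lemma controls_le (E E' : R) q h v x b : E <= E' ->
  controls E q h v x b -> controls E' q h v x b.
Proof.
move=> EE H t /H[hE tE qE qEb]; split; try by apply: le_trans EE.
by apply: le_trans qEb _; apply: ler_wpM2r.
Qed.

(** Every adherent point of a fibre is within 1 of a point of [S], where [|tau|] and the energy of
    the base point are bounded; so the power of the energy in [power_controls] becomes a
    constant. *)
Lemma bounded_controls S q h tau v : energy_bounded S ->
  polyfun q -> polyfun h -> polyfun tau ->
  (forall x t, tau (x + t *: v) = tau x + t) ->
  exists2 E, 1 <= E & forall x b, tau x = 0 -> line_adherent (fiber S v x) b ->
    q (x + b *: v) = 0 -> controls E q h v x b.
Proof.
move=> bS pq ph ptau tauv.
have [B HB] := polyfun_bounded bS ptau.
have [|B' HB'] := polyfun_bounded (F := fun x => energy (x + (- tau x) *: v)) bS.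
  apply: (@polyfun_comp _ _ false _ _ (polyfun_energy R n)).
  by apply: map_class_along; exact: (@fun_classN _ _ false).
have [A [j [A1 ctrl]]] := power_controls v (B + 1) 0 pq ph.
exists (A * Num.max 1 B' ^+ j).
  rewrite -[leLHS]mulr1; apply: ler_pM => //; rewrite ?(le_trans ler01) //.
  by apply: exprn_ege1; rewrite le_max lexx.
move=> x b tx Sb qb; have [r Sr rb] := Sb 1 ltr01.
have rB : `|r| <= B by have := HB _ Sr; rewrite tauv tx add0r.
have bB : `|b| <= B + 1.
  by have := ler_distD r b 0; rewrite !subr0 distrC; lra.
apply: controls_le (ctrl x b qb _); last by rewrite expr0 mulr1.
apply: ler_wpM2l; first by lra.
apply: lerXn2r; rewrite ?nnegrE; first by apply: le_trans (energy_ge1 x).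
  by rewrite le_max ler01.
rewrite le_max; apply/orP; right.
have := HB' _ Sr; rewrite tauv tx add0r -addrA -scalerDl subrr scale0r addr0.
exact: le_trans (ler_norm _).
Qed.

(** Boundedness is asked on the part with [affine k < 0], where [trim_parallel] needs its controls.
    This admits the first cut, made on an unbounded paraboloid. *)
Lemma polynomial_trim_parallel q s k v : polyfun q -> v != 0 -> dot k.1.1 v = 0 ->
  (forall x, is_interval [set t | q (x + t *: v) < 0]) ->
  (forall x, grows (fun t => q (x + t *: v))) ->
  (forall x, exists B, forall t, fiber (region q s) v x t -> `|t| <= B) ->
  energy_bounded (region q s `&` [set x | affine k x < 0]) ->
  is_image false (~` region q s) ->
  is_image false (~` (region q s `&` [set x | affine k x <= 0])).
Proof.
move=> pq v0 kv iq gq bq bS.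
pose u := (dot v v)^-1 *: v; have uv : dot u v = 1 by rewrite dotC normalized_direction.
have tauv x t : dot u (x + t *: v) = dot u x + t by rewrite dotDr dotZr uv mulr1.
have kline x t : affine k (x + t *: v) = affine k x by rewrite affine_line kv mulr0 addr0.
have prq := polyfun_region_poly s v pq.
have [E E1 ctrl] := bounded_controls bS prq (polyfun_affine k) (polyfun_dot u) tauv.
apply: (@trim_parallel _ _ false _ v (dot u) (affine k) (region_poly q s v) (fun=> E)) => //.
- exact: polyfun_affine.
- exact: polyfun_dot.
- exact: (fun_class_cst n false E^-1).
- by move=> x _ _; exact: ends_at_zeros_region.
- by move=> x _ _; split=> //; apply: grows_region_poly; left.
move=> x b ux kx Ib qb; apply: ctrl => // e e0; have [r Ir rb] := Ib e e0.
by exists r => //; split=> //=; rewrite kline.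
Qed.

Lemma polynomial_trim_transverse q s k : polyfun q -> k.1.1 != 0 ->
  (forall v, v != 0 -> forall x, is_interval [set t | q (x + t *: v) < 0]) ->
  (forall v, v != 0 -> forall x, grows (fun t => q (x + t *: v))) ->
  energy_bounded (region q s) -> is_image false (~` region q s) ->
  is_image false (~` (region q s `&` [set x | affine k x < 0])).
Proof.
move=> pq k0 iq gq bS; pose v := (dot k.1.1 k.1.1)^-1 *: k.1.1.
have kv : dot k.1.1 v = 1 by exact: normalized_direction.
have v0 : v != 0 by rewrite scaler_eq0 invr_eq0 (negPf k0) gt_eqF // dot_gt0.
have tauv x t : affine k (x + t *: v) = affine k x + t by rewrite affine_line kv mulr1.
have prq := polyfun_region_poly s v pq.
have [E E1 ctrl] := bounded_controls bS prq (polyfun_cst n (0 : R)) (polyfun_affine k) tauv.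
apply: (@trim_transverse _ _ false _ v (affine k) (region_poly q s v) (fun=> E)) => //.
- exact: polyfun_affine.
- exact: (fun_class_cst n false E^-1).
- by move=> x _; apply: ends_at_zeros_region => //; exact: iq.
- move=> x kx; split; first by apply: grows_region_poly; left; exact: gq.
  have [B HB] := polyfun_bounded bS (polyfun_affine k).
  by exists B => t /HB; rewrite tauv kx add0r; apply: le_trans; exact: ler_norm.
by move=> x b kx Ib _ _; exact: ctrl.
Qed.

(** This is [|x'|^2 - x_i - c], where [x'] collects the coordinates other than [i]. *)
Definition paraboloid (i : 'I_n) (c : R) x := dot x x - x 0 i ^+ 2 - x 0 i - c.

Lemma sqr_coord_le_dot x i : x 0 i ^+ 2 <= dot x x.
Proof. by rewrite /dot (bigD1 i) //= -expr2 lerDl; apply: sumr_ge0 => j _; rewrite -expr2 sqr_ge0. Qed.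

Lemma polyfun_paraboloid i c : polyfun (paraboloid i c).
Proof.
have pi : polyfun (fun x : 'rV[R]_n => x 0 i) by exact: polyfun_coord.
have pd : polyfun (fun x : 'rV[R]_n => dot x x).
  by apply: (@fun_class_sum _ _ false) => j; apply: polyfunM; exact: polyfun_coord.
apply: (@fun_classB _ _ false); last exact: polyfun_cst.
apply: (@fun_classB _ _ false); last exact: pi.
by apply: (@fun_classB _ _ false) => //; exact: (@fun_classX _ _ false).
Qed.

Lemma paraboloid_line i c x v t : paraboloid i c (x + t *: v) =
  (dot v v - v 0 i ^+ 2) * t ^+ 2 + (2 * dot x v - 2 * x 0 i * v 0 i - v 0 i) * t +
  paraboloid i c x.
Proof. by rewrite /paraboloid !(dotDl, dotDr, dotZl, dotZr) [dot v x]dotC !mxE; ring. Qed.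

Lemma is_interval_paraboloid i c x v : is_interval [set t | paraboloid i c (x + t *: v) < 0].
Proof.
rewrite (_ : [set _ | _] = [set t | (dot v v - v 0 i ^+ 2) * t ^+ 2 +
  (2 * dot x v - 2 * x 0 i * v 0 i - v 0 i) * t + paraboloid i c x < 0]).
  by apply: is_interval_quadratic; rewrite subr_ge0 sqr_coord_le_dot.
by apply/seteqP; split=> t /=; rewrite paraboloid_line.
Qed.

Lemma grows_paraboloid i c x v : v != 0 -> grows (fun t => paraboloid i c (x + t *: v)).
Proof.
move=> v0; rewrite (_ : (fun _ => _) = fun t => (dot v v - v 0 i ^+ 2) * t ^+ 2 +
  (2 * dot x v - 2 * x 0 i * v 0 i - v 0 i) * t + paraboloid i c x); last first.
  by apply/funext => t; rewrite paraboloid_line.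
have [vi|vi] := eqVneq (dot v v - v 0 i ^+ 2) 0; last exact: grows_quadratic.
(* The leading coefficient is the squared length of [v] minus its [i]-th component; if it vanishes,
   [v] is on the axis and the paraboloid is linear in [t]. *)
have ve : v = v 0 i *: delta_mx 0 i.
  apply/eqP; rewrite -subr_eq0; apply/negPn/negP => /dot_gt0.
  rewrite !(dotBl, dotBr, dotZl, dotZr) !dot_delta [dot (delta_mx _ _) v]dotC !dot_delta.
  by rewrite !mxE !eqxx /=; nra.
have vi0 : v 0 i != 0 by apply: contra v0 => /eqP e; rewrite ve e scale0r.
rewrite (_ : (fun _ => _) = fun t => - v 0 i * t + paraboloid i c x).
  by apply: grows_linear; rewrite oppr_eq0.
by apply/funext => t; rewrite vi {1}ve dotZr dot_delta; ring.
Qed.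

Lemma image_above_paraboloid i c : is_image false (~` [set x | paraboloid i c x < 0]).
Proof.
apply: (image_above (v := - delta_mx 0 i)); first exact: polyfun_paraboloid.
move=> x t; rewrite paraboloid_line !dotNr [dot (- _) _]dotC dotNr !dot_delta !mxE !eqxx /=.
ring.
Qed.

Lemma energy_bounded_cap i c M :
  energy_bounded [set x | paraboloid i c x < 0 /\ x 0 i <= M].
Proof.
exists (1 + c ^+ 2 + M ^+ 2 + M + c) => x [].
have := sqr_coord_le_dot x i; rewrite /paraboloid /energy.
move: (dot x x) (x 0 i) => d r d0 px rM.
have rc : - c <= r by lra.
have : r ^+ 2 <= c ^+ 2 + M ^+ 2 by have [r0|r0] := leP 0 r; nra.
lra.
Qed.

Lemma polynomial_system s : (forall k, k \in s -> k.1.1 != 0) ->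
  energy_bounded (system s) -> is_image false (~` system s).
Proof.
move=> s0 [M HM]; pose i0 := Ordinal (ltnW n1); pose i1 := Ordinal n1.
(* Energy at most [M] bounds [|x|^2] and [|x_0|] by [M], so this [c] places the system inside the
   cap [q < 0], [x_0 <= M], and adding the cap changes nothing. *)
pose c := 2 * M + 1; pose q := paraboloid i0 c.
pose top : constraint R n := (delta_mx 0 i0, - M, false).
have topE x : affine top x = x 0 i0 - M by rewrite /affine dotC dot_delta.
have bounded l : top \in l -> energy_bounded (region q l).
  move=> tl; apply: energy_boundedS (energy_bounded_cap i0 c M) => x [qx /allP/(_ _ tl)].
  by rewrite /satisfies topE /= subr_le0.
have pq : polyfun q by exact: polyfun_paraboloid.
have -> : system s = region q (s ++ [:: top]).
  apply/seteqP; split=> [x|x [_]]; last by rewrite all_cat => /andP[sx _]; split=> //; lra.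
  move=> sx; have eM := HM x sx; case: sx => _ sx.
  have xM := coord_le_energy x i0; have := ler_norm (x 0 i0); have := ler_norm (- x 0 i0).
  rewrite normrN => x1 x2; have := sqr_ge0 (x 0 i0); rewrite /energy in eM xM => x3.
  split; first by rewrite /q /paraboloid /c; lra.
  by rewrite all_cat sx /= /satisfies topE /=; lra.
suff H l : {subset l <= s} -> is_image false (~` region q (l ++ [:: top])) by exact: H.
elim: l => [_|k l IH ls] /=.
  (* The cap is cut along the second axis, parallel to [x_0 = M], on which [q] is quadratic with
     leading coefficient 1 and the fibres are bounded. *)
  have nz (v := delta_mx 0 i1 : 'rV[R]_n) : v != 0.
    by apply/eqP => /rowP/(_ i1); rewrite !mxE !eqxx => /eqP; rewrite oner_eq0.
  rewrite region_cons; apply: (polynomial_trim_parallel pq nz).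
  - by rewrite dot_delta !mxE.
  - by move=> x; exact: is_interval_paraboloid.
  - by move=> x; exact: grows_paraboloid.
  - move=> x; have [T HT] := quadratic_ge0 (2 * dot x (delta_mx 0 i1)) (q x) ltr01.
    exists T => t [qt _]; rewrite leNgt; apply/negP => /ltW/HT.
    move: qt; rewrite /q paraboloid_line !dot_delta !mxE /=; lra.
  - apply: energy_boundedS (energy_bounded_cap i0 c M) => x [[qx _]] /=.
    by rewrite topE => xM; split=> //; lra.
  rewrite (_ : region q [::] = [set x | q x < 0]); first exact: image_above_paraboloid.
  by apply/seteqP; split=> [x []|x].
have iS : is_image false (~` region q (l ++ [:: top])).
  by apply: IH => k' k'l; apply: ls; rewrite inE k'l orbT.
have k0 : k.1.1 != 0 by apply: s0; apply: ls; rewrite inE eqxx.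
have bS : energy_bounded (region q (l ++ [:: top])).
  by apply: bounded; rewrite mem_cat inE eqxx orbT.
rewrite region_cons; case k2 : (k.2); rewrite /satisfies k2.
  apply: polynomial_trim_transverse => //.
    by move=> v _ x; exact: is_interval_paraboloid.
  by move=> v v0 x; exact: grows_paraboloid.
have [v v0 kv] := orthogonal_direction k.1.1 n1.
apply: (polynomial_trim_parallel pq v0) => //.
- by move=> x; exact: is_interval_paraboloid.
- by move=> x; exact: grows_paraboloid.
- pose u := (dot v v)^-1 *: v; have uv : dot u v = 1 by rewrite dotC normalized_direction.
  have [B HB] := polyfun_bounded bS (polyfun_dot u) => x.
  exists (B + `|dot u x|) => t /HB; rewrite dotDr dotZr uv mulr1.
  by have := ler_normB (dot u x + t) (dot u x); rewrite addrC addKr; lra.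
by apply: energy_boundedS bS => x [].
Qed.

End PolynomialSystems.

(** * Polyhedra *)

Section Polyhedra.
Variables (R : realType) (n : nat).
Implicit Types (x y z v w a : 'rV[R]_n) (k : constraint R n) (s : seq (constraint R n)).
Implicit Types (h p : mpoly n R) (K : set 'rV[R]_n).

Lemma degree_oneP h : degree_one h <->
  (forall m, (1 < mdeg m)%N -> mcoeff m h = 0) /\ exists i, mcoeff (mnm1 i) h != 0.
Proof.
rewrite /degree_one; split=> [h2|[h0 [i hi]]].
  split=> [m m2|]; first by apply: memN_msupp_eq0; apply: msize_mdeg_ge; rewrite h2.
  have nz : h != 0 by apply/eqP => h0; move: h2; rewrite h0 msize0.
  have := mlead_deg nz; rewrite h2 => -[/eqP/mdeg1P[i /eqP mi]].
  by exists i; rewrite -mi mleadc_eq0.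
apply/eqP; rewrite eqn_leq; apply/andP; split; last first.
  by have := @msize_mdeg_lt _ _ h (mnm1 i); rewrite mdeg1; apply; rewrite -[_ \in _]negbK -mcoeff_eq0.
rewrite msizeE; apply/bigmax_leqP_seq => m mh _.
by rewrite ltnNge; apply/negP => /h0/eqP; rewrite mcoeff_eq0 mh.
Qed.

Lemma degree_one_affine h : degree_one h ->
  exists2 a, a != 0 & forall x, peval h x = dot a x + mcoeff (@mnm0 n) h.
Proof.
move=> /degree_oneP[h0 [i hi]]; exists (\row_j mcoeff (mnm1 j) h).
  by apply: contra hi => /eqP/rowP/(_ i); rewrite !mxE => ->.
move=> x; have {1}-> : h = \sum_j (mcoeff (mnm1 j) h *: mpolyX R (mnm1 j)) + mpolyC n (mcoeff (@mnm0 n) h).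
  apply/mpolyP => m; rewrite mcoeffD mcoeffC raddf_sum /=.
  have cm j : mcoeff m (mcoeff (mnm1 j) h *: mpolyX R (mnm1 j)) =
      mcoeff (mnm1 j) h * (mnm1 j == m)%:R by rewrite mcoeffZ mcoeffX.
  under eq_bigr => j _ do rewrite cm.
  (* Coefficients are compared in degree 0, above 1, and equal to 1. *)
  case: (ltngtP (mdeg m) 1%N) => md.
  - have /eqP m0 : m == (@mnm0 n) by rewrite -mdeg_eq0 -leqn0 -ltnS.
    rewrite m0 eqxx mulr1 big1 ?add0r // => j _.
    case: eqP => [/(congr1 mdeg)|]; last by rewrite mulr0.
    by rewrite mdeg1 mdeg0.
  - rewrite h0 // (_ : (m == (@mnm0 n)) = false); last by rewrite -mdeg_eq0; case: (mdeg m) md.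
    rewrite mulr0 addr0 big1 // => j _; case: eqP => [mj|]; last by rewrite mulr0.
    by move: md; rewrite -mj mdeg1.
  - have /mdeg1P[j /eqP mj] : mdeg m == 1%N by apply/eqP.
    rewrite mj (bigD1 j) //= eqxx mulr1 big1 ?addr0 => [|j' j'j].
      by rewrite (_ : (_ == _) = false) ?mulr0 ?addr0 // -mdeg_eq0 mdeg1.
    by rewrite eq_mnm1 (negPf j'j) mulr0.
rewrite pevalD pevalC; congr (_ + _); rewrite /peval raddf_sum /dot.
by apply: eq_bigr => j _ /=; rewrite mevalZ mevalXU mxE.
Qed.

(** Signs are reversed to get [- h <= 0]; [h] is remembered in order to exhibit a hyperplane
    later. *)
Lemma convex_polyhedronP K : convex_polyhedron K -> exists s,
  (forall k, k \in s -> [/\ k.1.1 != 0, ~~ k.2 &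
     exists2 h, degree_one h & forall x, affine k x = - peval h x]) /\ K = system s.
Proof.
move=> [m [h [hd ->]]].
have /choice[a aP] i : exists a, a != 0 /\ forall x, peval (h i) x = dot a x + mcoeff (@mnm0 n) (h i).
  by have [a a0 ha] := degree_one_affine (hd i); exists a.
pose f i : constraint R n := (- a i, - mcoeff (@mnm0 n) (h i), false).
have fE i x : affine (f i) x = - peval (h i) x.
  by rewrite /affine (aP i).2 dotC dotNr dotC opprD.
exists [seq f i | i <- enum 'I_m]; split.
  move=> k /mapP[i _ ->]; rewrite oppr_eq0; split=> //; first exact: (aP i).1.
  by exists (h i).
apply/seteqP; split=> x.
  move=> hx; split; first lra.
  apply/allP => k /mapP[i _ ->]; rewrite /satisfies fE /=.
  by rewrite oppr_le0; exact: hx.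
move=> [_ /allP sx] i _ /=; have := sx (f i) (map_f _ (mem_enum _ _)).
by rewrite /satisfies fE /= oppr_le0.
Qed.

Lemma continuous_affine k : continuous (affine k).
Proof.
move: (affine k) (polyfun_affine k); apply: peval_ind => [c|i|F G cF cG|F G cF cG] x.
- exact: cst_continuous.
- exact: coord_continuous.
- exact: (@continuousD _ _ _ F G x (cF x) (cG x)).
- exact: (@continuousM _ _ F G x (cF x) (cG x)).
Qed.

Lemma affine_comb k m (p : 'I_m -> 'rV[R]_n) (w : 'I_m -> R) : \sum_i w i = 1 ->
  affine k (\sum_i w i *: p i) = \sum_i w i * affine k (p i).
Proof.
move=> w1; rewrite /affine; under [RHS]eq_bigr do rewrite mulrDr.
rewrite big_split /= -mulr_suml w1 mul1r; congr (_ + _).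
have dotsum (r : seq 'I_m) : dot k.1.1 (\sum_(i <- r) w i *: p i) =
    \sum_(i <- r) w i * dot k.1.1 (p i).
  elim: r => [|i r IH]; last by rewrite !big_cons dotDr dotZr IH.
  by rewrite !big_nil -(scale0r (0 : 'rV[R]_n)) dotZr mul0r.
exact: dotsum.
Qed.

(* Inside the affine span of [K], a constraint which vanishes identically on [K]
   holds everywhere, and the others must become strict. *)
Definition interior_constraint K k : constraint R n :=
  (k.1, ~~ `[< forall x, K x -> affine k x = 0 >]).

Lemma sub_affine_span K : K `<=` affine_span K.
Proof.
move=> x Kx; exists 1%N, (fun=> x), (fun=> 1).
by rewrite !big_ord1 scale1r.
Qed.

(** If [affine k] vanishes at [x] but is negative at some [y] in [K], moving from [y] slightly past
    [x] stays in the span and leaves [K], so [x] is not interior. Conversely strict inequalities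
    persist nearby, and affine functions vanishing on [K] vanish on its span. *)
Lemma Int_system s : (forall k, k \in s -> ~~ k.2) ->
  Int (system s) = system [seq interior_constraint (system s) k | k <- s].
Proof.
move=> s2; set K := system s; set A := affine_span K.
have satE k x : k \in s -> satisfies k x = (affine k x <= 0).
  by move=> /s2/negPf k2; rewrite /satisfies k2.
apply/seteqP; split=> x.
  move=> Ix; have Kx : K x by exact: interior_subset Ix.
  have Ax := sub_affine_span Kx; split; first lra.
  apply/allP => _ /mapP[k ks ->]; rewrite /satisfies /interior_constraint /=.
  have kx : affine k x <= 0 by rewrite -satE //; exact: (allP Kx.2).
  rewrite /affine -/(affine k x) /=; case: ifPn => // /asboolPn/existsNP[y /not_implyP[Ky ky]].
  rewrite lt_neqAle kx andbT; apply/eqP => kx0.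
  have ky0 : affine k y < 0.
    by rewrite lt_neqAle; apply/andP; split; [exact/eqP | rewrite -satE //; exact: (allP Ky.2)].
  have /(nbhs_subspace_ex _ Ax)[V xV KV] : nbhs (x : subspace A) K by exact: Ix.
  have /nbhs_ballP[e /= e0 eV] := xV.
  (* The summand 1 keeps the divisor positive; the step [d *: (x - y)] is shorter than [e]. *)
  pose d := e / (1 + `|x - y|) / 2.
  have d1 : 0 < 1 + `|x - y| by have := normr_ge0 (x - y); lra.
  have d0 : 0 < d by rewrite !divr_gt0.
  pose z := x + d *: (x - y).
  have zV : V z.
    apply: eV; rewrite -ball_normE /ball_ /= /z opprD addrA subrr add0r normrN normrZ.
    rewrite gtr0_norm //; have : d * (1 + `|x - y|) = e / 2.
      by rewrite /d mulrAC divfK // gt_eqF.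
    by lra.
  have zA : A z.
    exists 2%N, (fun i : 'I_2 => if i == ord0 then x else y),
      (fun i : 'I_2 => if i == ord0 then 1 + d else - d); split.
    - by move=> i; case: ifP.
    - by rewrite big_ord_recl big_ord1 /=; ring.
    - rewrite big_ord_recl big_ord1 /= /z scalerDl scale1r scalerBr scaleNr.
      by rewrite addrA.
  have [Kz _] : (K `&` A) z by rewrite KV.
  have := allP Kz.2 k ks; rewrite satE // /z affine_line kx0 add0r dotBr.
  have : dot k.1.1 x - dot k.1.1 y = affine k x - affine k y by rewrite /affine; ring.
  by move=> ->; rewrite kx0; nra.
move=> [_ sx].
have Kx : K x.
  split; first lra; apply/allP => k ks; rewrite satE //.
  have /(allP sx) : interior_constraint K k \in [seq interior_constraint K k | k <- s].
    exact: map_f.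
  exact: satisfies_le0.
have Ax := sub_affine_span Kx.
(* Only the strict constraints define the open neighbourhood; the others hold on the span. *)
pose V := [set y | all (fun k => satisfies (interior_constraint K k) y ||
  ~~ (interior_constraint K k).2) s].
have xV : nbhs x V.
  have: all (fun k => satisfies (interior_constraint K k) x) s.
    by move: sx; rewrite all_map.
  rewrite /V; elim: (s) => [_|k l IH /= /andP[kx /IH lx]]; first by apply: filterS filterT.
  rewrite (_ : [set _ | _] = [set y | satisfies (interior_constraint K k) y ||
    ~~ (interior_constraint K k).2] `&` [set y | all (fun k => satisfies
    (interior_constraint K k) y || ~~ (interior_constraint K k).2) l]); last first.
    by apply/seteqP; split=> y /=; [move/andP | move/andP].
  apply: filterI => //.
  case kt : (interior_constraint K k).2; last by apply: filterS filterT => y _; rewrite /= orbT.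
  rewrite /satisfies kt in kx *.
  have /cvgr_lt/(_ _ kx) := @continuous_affine (interior_constraint K k) x.
  by apply: filterS => y /= ->.
suff H : within A (nbhs x) K by move: H; rewrite (nbhs_subspace_in Ax).
apply: filterS xV => y Vy Ay; split; first lra.
apply/allP => k ks; rewrite satE //.
have := allP Vy k ks; rewrite /satisfies /interior_constraint /=.
case: asboolP => [kt _|_]; last by rewrite /= orbF => /ltW.
have [m [p [w [pK w1 ->]]]] := Ay.
by rewrite affine_comb // big1 // => i _; rewrite kt ?mulr0.
Qed.

End Polyhedra.

(** * Bounded sets, and systems whose normals are all parallel *)

Section Degenerate.
Variables (R : realType) (n : nat).
Hypothesis n1 : (1 < n)%N.
Implicit Types (x y z v w a : 'rV[R]_n) (k : constraint R n) (s : seq (constraint R n)).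
Implicit Types (K : set 'rV[R]_n).

Lemma bounded_set_energy K : bounded_set K -> energy_bounded K.
Proof.
move=> [N [_ /(_ (N + 1))]]; rewrite ltrDl ltr01 => /(_ isT) /=.
set M := N + 1 => KM; exists (1 + \sum_(i < n) M * M) => x Kx.
rewrite /energy lerD2l; apply: ler_sum => i _.
have xM : `|x 0 i| <= M.
  apply: le_trans (KM x Kx); rewrite -[`|x|]/(mx_norm x) mx_normrE.
  exact: (le_bigmax _ (fun ij => `|x ij.1 ij.2|) (0, i)).
by rewrite -expr2 -real_normK ?num_real // expr2; apply: ler_pM.
Qed.

(* [None] stands for an infinite end. *)
Definition slice a (l u : option R) := [set x | (forall r, l = Some r -> r <= dot a x) /\
  (forall r, u = Some r -> dot a x <= r)].

(** A constraint with normal [r *: a] is an upper bound on [dot a x] if [r > 0] and a lower bound if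
    [r < 0]; the slice is updated by a minimum or a maximum. *)
Lemma collinear_system a s :
  (forall k, k \in s -> [/\ k.1.1 != 0, ~~ k.2 & exists r, k.1.1 = r *: a]) ->
  exists l u, system s = slice a l u.
Proof.
elim: s => [_|k s IH sP].
  by exists None, None; apply/seteqP; split=> x // _; split=> //; lra.
have [|l [u lu]] := IH; first by move=> k' k's; apply: sP; rewrite inE k's orbT.
have [k0 /negPf k2 [r kr]] := sP k (mem_head _ _).
have r0 : r != 0 by apply: contra k0; rewrite kr => /eqP->; rewrite scale0r.
have satE x : satisfies k x = (r * dot a x <= - k.1.2).
  by rewrite /satisfies k2 /affine kr dotZl -lerBrDr sub0r.
rewrite /system region_cons -/(system s) lu; pose t := - k.1.2 / r.
have [rpos|rneg] := ltP 0 r.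
  have kE x : satisfies k x = (dot a x <= t) by rewrite satE /t ler_pdivlMr // mulrC.
  exists l, (if u is Some m then Some (Num.min m t) else Some t).
  apply/seteqP; split=> x.
    move=> [[xl xu]]; rewrite /= kE => xt; split=> // m.
    by case: u xu {lu} => [m'|] xu [<-] //; rewrite le_min xt xu.
  move=> [xl xu]; rewrite /= kE.
  case: u xu {lu} => [m'|] xu; have := xu _ erefl; rewrite ?le_min.
    by move=> /andP[xm xt]; split=> //; split=> // m [<-].
  by move=> xt; split=> //; split.
have {}rneg : r < 0 by rewrite lt_neqAle r0.
have kE x : satisfies k x = (t <= dot a x) by rewrite satE /t ler_ndivrMr // mulrC.
exists (if l is Some m then Some (Num.max m t) else Some t), u.
apply/seteqP; split=> x.
  move=> [[xl xu]]; rewrite /= kE => xt; split=> // m.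
  by case: l xl {lu} => [m'|] xl [<-] //; rewrite ge_max xt xl.
move=> [xl xu]; rewrite /= kE.
case: l xl {lu} => [m'|] xl; have := xl _ erefl; rewrite ?ge_max.
  by move=> /andP[xm xt]; split=> //; split=> // m [<-].
by move=> xt; split=> //; split.
Qed.

(** The column [u = a^T] has rank 1 and factors as [L * pid_mx 1 * r] with [L] invertible;
    [A = r^-1 L^-1] sends it to the first basis column. *)
Lemma unit_direction a : a != 0 ->
  exists2 A : 'M[R]_n, A \in unitmx & forall (i : 'I_n) y, i = 0%N :> nat -> dot a (y *m A) = y 0 i.
Proof.
move=> a0; pose u := a^T.
have u0 : u != 0 by apply: contra a0 => /eqP e; rewrite -[a]trmxK -/u e trmx0.
have ru : \rank u = 1%N by apply/eqP; rewrite eqn_leq rank_leq_col lt0n mxrank_eq0.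
have uE := mulmx_ebase u; rewrite ru in uE.
pose r := row_ebase u 0 0; have rE : row_ebase u = r%:M by exact: mx11_scalar.
have r0 : r != 0.
  by have := row_ebase_unit u; rewrite rE unitmxE det_scalar1 unitfE.
have Lu := col_ebase_unit u.
exists (r^-1 *: invmx (col_ebase u)); first by rewrite unitmxZ ?unitmx_inv ?unitfE ?invr_eq0.
move=> i y i0.
have -> : dot a (y *m (r^-1 *: invmx (col_ebase u))) =
    (y *m (r^-1 *: invmx (col_ebase u)) *m u) 0 0.
  by rewrite [RHS]mxE dotC; apply: eq_bigr => j _; rewrite [u _ _]mxE.
have Au : r^-1 *: invmx (col_ebase u) *m u = pid_mx 1.
  rewrite -[in X in _ *m X]uE rE mulmxA -scalemxAl mulmxA mulVmx // mul1mx.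
  by rewrite -scalemxAl mul_mx_scalar scalerA mulVf // scale1r.
rewrite -mulmxA Au mxE (bigD1 i) //= big1 => [|j ji].
  by rewrite addr0 mxE i0 eqxx mulr1.
rewrite mxE (_ : (_ == _) && _ = false) ?mulr0 //; apply/negP => /andP[/eqP j0 _].
by move/eqP: ji; apply; apply: val_inj; rewrite /= i0 j0.
Qed.

Lemma slice_layer a (l u : R) : a != 0 -> l < u -> layer (slice a (Some l) (Some u)).
Proof.
move=> a0 lu; have [A Au dA] := unit_direction a0.
pose b := ((l + u) / 2) *: ((dot a a)^-1 *: a).
have ab : dot a b = (l + u) / 2 by rewrite dotZr normalized_direction // mulr1.
exists ((u - l) / 2), A, b; split=> //; first lra.
pose i0 := Ordinal (ltnW n1).
apply/seteqP; split=> [x [/(_ _ erefl) lx /(_ _ erefl) xu]|_ [y yP <-]].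
  have xE : (x - b) *m invmx A *m A + b = x by rewrite mulmxKV // subrK.
  exists ((x - b) *m invmx A) => // i i_0; rewrite -(dA i _ i_0) mulmxKV // dotBr ab; lra.
have := yP i0 erefl; rewrite -(dA i0 _ erefl) => yb.
by split=> _ [<-]; rewrite dotDr ab; lra.
Qed.

Lemma slice_hyperplane (h : mpoly n R) a c l : degree_one h ->
  (forall x, dot a x + c = - peval h x) -> hyperplane (slice a (Some l) (Some l)).
Proof.
(* [dot a x = l] amounts to [peval h x + c + l = 0], and a constant term does not affect the
   degree. *)
move=> hd hE; exists (h + mpolyC n (c + l)); split.
  have [h0 [i hi]] := (degree_oneP h).1 hd; apply/degree_oneP; split=> [m m1|].
    rewrite mcoeffD h0 // mcoeffC (_ : (m == _) = false) ?mulr0 ?addr0 //.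
    by rewrite -mdeg_eq0; case: (mdeg m) m1.
  exists i; rewrite mcoeffD mcoeffC (_ : (mnm1 i == _) = false) ?mulr0 ?addr0 //.
  by rewrite -mdeg_eq0 mdeg1.
apply/seteqP; split=> x; have := hE x; rewrite /= pevalD pevalC => xE.
  by move=> [/(_ _ erefl) lx /(_ _ erefl) xl]; lra.
by move=> e; split=> _ [<-]; lra.
Qed.

Lemma slice_halfspace a (l u : option R) : a != 0 -> (l == None) != (u == None) ->
  exists2 k, k.1.1 != 0 /\ ~~ k.2 & slice a l u = system [:: k].
Proof.
move=> a0; case: l u => [l|] [u|] // _.
  exists (- a, l, false); first by rewrite oppr_eq0.
  apply/seteqP; split=> x; rewrite /system region_cons /= /satisfies /affine /= dotC dotNr dotC.
    by move=> [/(_ _ erefl) lx _]; split; [split=> //; lra | lra].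
  by move=> [_ lx]; split=> // _ [<-]; lra.
exists (a, - u, false); first by [].
apply/seteqP; split=> x; rewrite /system region_cons /= /satisfies /affine /=.
  by move=> [_ /(_ _ erefl) xu]; split; [split=> //; lra | lra].
by move=> [_ xu]; split=> // _ [<-]; lra.
Qed.

End Degenerate.

Theorem theorem1 (R : realType) (n : nat) (hn : (2 <= n)%N)
  (K : set 'rV[R]_n)
  (K_polyhedron : convex_polyhedron K)
  (K_proper : K `<` [set: 'rV[R]_n])
  (K_not_layer : ~ layer K)
  (K_not_hyperplane : ~ hyperplane K) :
  (bounded_set K ->
     polynomial_image n (~` K) /\ polynomial_image n (~` Int K)) /\
  (~ bounded_set K ->
     regular_image n (~` K) /\ regular_image n (~` Int K)).
Proof.
have [s [sP KE]] := convex_polyhedronP K_polyhedron.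
pose s' := [seq interior_constraint K k | k <- s].
have IntE : Int K = system s' by rewrite /s' KE; apply: Int_system => k /sP[].
have s0 k : k \in s -> k.1.1 != 0 by case/sP.
have s'0 k : k \in s' -> k.1.1 != 0 by case/mapP => k' /s0 k'0 ->.
split=> [/bounded_set_energy bK|uK].
  split; apply: is_image_poly; rewrite ?IntE.
    by rewrite KE; apply: polynomial_system; rewrite // -KE.
  apply: polynomial_system => //; rewrite -IntE.
  by apply: energy_boundedS bK => x Ix; exact: interior_subset Ix.
suff [iK iI] : is_image true (~` K) /\ is_image true (~` Int K).
  by split; exact: is_image_reg.
(* Passing to [Int K] keeps the normals, so two nonparallel constraints settle both complements;
   otherwise all normals are multiples of one. *)
have [[k1 [k2 [k1s k2s npar]]]|par] := pselect (exists k1 k2,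
    [/\ k1 \in s, k2 \in s & ~ exists r, k2.1.1 = r *: k1.1.1]).
  rewrite IntE KE; split; first exact: (regular_system hn s0 k1s k2s).
  have ks' k : k \in s -> interior_constraint K k \in s' by exact: map_f.
  exact: (regular_system hn s'0 (ks' _ k1s) (ks' _ k2s)).
case Es : s => [|k0 t].
  case: K_proper => _ []; rewrite KE Es => x _; split=> //; lra.
have k0s : k0 \in s by rewrite Es mem_head.
have [k00 _ [h hd hE]] := sP _ k0s.
have [|l [u lu]] := @collinear_system _ _ k0.1.1 s.
  move=> k ks; have [kn k2 _] := sP _ ks; split=> //.
  by apply: contrapT => npar; apply: par; exists k0, k.
rewrite -KE in lu.
(* Exactly one finite end gives a half-space. *)
have [/eqP|lu1] := boolP ((l == None) == (u == None)); last first.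
  have [k [kn k2] sE] := slice_halfspace k00 lu1.
  rewrite lu sE; split; first exact: regular_halfspace.
  by rewrite Int_system => [|k']; [exact: regular_halfspace | rewrite inE => /eqP ->].
case: l u lu => [l|] [u|] lu // _; last first.
  by case: K_proper => _ []; rewrite lu => x _; split.
(* Two finite ends give a layer if [l < u] and a hyperplane if [l = u]; for [l > u] the slice is
   empty, hence bounded. *)
case: (ltgtP l u) => lu1.
- by case: K_not_layer; rewrite lu; exact: slice_layer.
- case: uK; rewrite lu (_ : slice _ _ _ = set0); first by exists 0; split=> [|M _ x []]; rewrite ?real0.
  by apply/seteqP; split=> // x [/(_ _ erefl) lx /(_ _ erefl) xu]; have := le_trans lx xu; rewrite leNgt lu1.
- by case: K_not_hyperplane; rewrite lu lu1; exact: slice_hyperplane hd hE.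
Qed.
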